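(* Let $d\ge 2$, $\beta>0$, $h\ge 0$, $J\in\{-1,+1\}$, and let $\mathbb{P}$ be the law on $\Omega=\{-1,+1\}^{\mathbb{Z}^d}$ of a Markov random field $\mathbb{X}=\{X_x\}_{x\in\mathbb{Z}^d}$ with single-site conditional probabilities $$\mathbb{P}\big(X_x=+1\,\big|\,X_{\mathbb{Z}^d\setminus x}=\sigma_{\mathbb{Z}^d\setminus x}\big)=\frac{e^{\beta h}e^{\beta J\sum_{y\sim x}\sigma_y}}{2\cosh\big(\beta h+\beta J\sum_{y\sim x}\sigma_y\big)}.$$ Let $p=e^{-2\beta h}\big(e^{4\beta d}-e^{-4\beta d}\big)$, assume $p<1$, and let $c'=4\beta d$. Suppose $$\sum_{n\ge 1} n(2d-1)^n e^{c'n}\,\mathbb{P}_p(|\mathcal{C}|\ge n)^{1/2}<\infty,$$ where $\mathcal{C}$ is the open cluster of the origin in independent Bernoulli site percolation on $\mathbb{Z}^d$ with parameter $p$ and $\mathbb{P}_p$ is its law. Then $\mathbb{P}$ satisfies the Poincaré inequality: there is $C_P>0$ such that for all $f\in L^2(\mathbb{P})$, $$\int\big(f-\mathbb{E}(f)\big)^2\,d\mathbb{P}\le C_P\,\mathcal{E}(f,f).$$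
   Context: $x\sim y$ means $x,y$ are nearest neighbours in $\mathbb{Z}^d$. For $\eta\in\Omega$ and $x\in\mathbb{Z}^d$, $\eta^x$ denotes the configuration obtained from $\eta$ by flipping the spin at $x$ (i.e. $\eta^x_x=-\eta_x$, $\eta^x_y=\eta_y$ for $y\ne x$), and $\nabla_x f(\eta)=f(\eta^x)-f(\eta)$. The quadratic form is $\mathcal{E}(f,f)=\sum_{x\in\mathbb{Z}^d}\int(\nabla_x f)^2\,d\mathbb{P}$ (possibly infinite). *)

(* Defs.v *)
From HB Require Import structures.
From mathcomp Require Import all_boot all_order all_algebra.
From mathcomp Require Import all_classical all_reals all_analysis.
Unset Printing Implicit Defensive.
Import Order.TTheory GRing.Theory Num.Theory.
Local Open Scope classical_set_scope.
Local Open Scope ring_scope.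

Definition site (d : nat) := {ffun 'I_d -> int}.
Definition shift {d : nat} (x : site d) (i : 'I_d) (k : int) : site d :=
  [ffun j => if j == i then x j + k else x j].
Definition nn {d : nat} (x y : site d) : Prop :=
  exists i : 'I_d, y = shift x i 1 \/ y = shift x i (-1).
Definition origin (d : nat) : site d := [ffun => 0].

(* a configuration; [true] encodes the spin +1, [false] the spin -1 *)
Definition config (d : nat) := site d -> bool.
Definition coord_sets (d : nat) : set (set (config d)) :=
  [set A | exists (y : site d) (b : bool), A = [set s : config d | s y = b]].
Definition Omega (d : nat) := g_sigma_algebraType (coord_sets d).
Definition Omega_disp (d : nat) := sigma_display (coord_sets d).

Definition off_site_sets {d : nat} (x : site d) : set (set (config d)) :=
  <<s [set A | exists (y : site d) (b : bool), y <> x /\ A = [set s : config d | s y = b]] >>.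

Definition spin {R : realType} (b : bool) : R := if b then 1 else -1.

Definition nbr_sum {R : realType} {d : nat} (s : config d) (x : site d) : R :=
  \sum_(i < d) (spin (s (shift x i 1)) + spin (s (shift x i (-1)))).

Definition cond_plus {R : realType} {d : nat} (beta h J : R) (x : site d)
    (s : config d) : R :=
  expR (beta * h) * expR (beta * J * nbr_sum s x) /
    (2 * ((expR (beta * h + beta * J * nbr_sum s x) +
           expR (- (beta * h + beta * J * nbr_sum s x))) / 2)).

Definition ising_single_site {R : realType} {d : nat} (beta h J : R)
    (P : probability (Omega d) R) : Prop :=
  forall (x : site d) (B : set (Omega d)), off_site_sets x B ->
    (P ([set s : Omega d | s x = true] `&` B) =
     \int[P]_(s in B) (cond_plus beta h J x s)%:E)%E.

Definition bernoulli_site_percolation {R : realType} {d : nat}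
    (Q : probability (Omega d) R) (p : R) : Prop :=
  forall (L : seq (site d)) (eta : site d -> bool), uniq L ->
    (Q [set w : Omega d | forall y, y \in L -> w y = eta y] =
     (\prod_(y <- L) (if eta y then p else 1 - p))%:E)%E.

Definition in_open_cluster {d : nat} (w : config d) (y : site d) : Prop :=
  exists s : seq (site d),
    [/\ last (origin d) s = y,
        (forall z, z \in origin d :: s -> w z = true) &
        (forall k, (k.+1 < size (origin d :: s))%N ->
           nn (nth (origin d) (origin d :: s) k) (nth (origin d) (origin d :: s) k.+1))].

Definition cluster_ge {d : nat} (n : nat) : set (Omega d) :=
  [set w | exists L : seq (site d),
     [/\ uniq L, size L = n & forall y, y \in L -> in_open_cluster w y]].

Definition flip {d : nat} (x : site d) (s : config d) : config d :=
  fun y => if y == x then ~~ s x else s y.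

Definition dirichlet_form {R : realType} {d : nat} (P : probability (Omega d) R)
    (f : Omega d -> R) : \bar R :=
  (\esum_(x in [set: site d]) \int[P]_(s in [set: Omega d]) ((f (flip x s) - f s) ^+ 2)%:E)%E.

(* Main.v *)
(** For [p] as in the statement, a straight segment of [n] open sites shows that
    [P_p(|C| >= n) >= p ^ n], so convergence of the series forces
    [(2d - 1)^2 p < 1], hence [4 d p <= 1].  On the other hand [p] bounds the
    oscillation of each single-site conditional probability, so we are well
    inside Dobrushin's uniqueness regime.

    For a finite set [L] of sites let [K = 1 - tau sum_{x in L} (1 - K_x)], where
    [K_x] resamples the spin at [x].  [K] is self-adjoint in [L^2(P)] and
    [<f, (1 - K) f> = tau sum_{x in L} E(pi_x (1 - pi_x) (nabla_x f)^2)].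
    The sum over [L] of the one-site oscillations of [K^m f] decays
    geometrically; since [m |-> <K^m f, (1 - K) K^m f>] is log-convex, that decay
    rate, a priori with a constant depending on [f] and [L], holds with constant
    one, and telescoping gives
    [|f|^2 - |K^m f|^2 <= C sum_{x in L} E (nabla_x f)^2] with [C] independent of
    [L].  For a local function, weighting the oscillations by powers of 2 along
    the successive neighbourhoods of its support shows that [K^m f] is
    uniformly close to [E f] when [L] and [m] are large; by density of local
    functions in [L^2(P)] this yields the Poincare inequality for bounded
    functions, and truncation gives the general case. *)
Require Import Defs.
From HB Require Import structures.
From mathcomp Require Import all_boot all_order all_algebra.
From mathcomp Require Import all_classical all_reals all_analysis.
From mathcomp Require Import measurable_realfun ring lra.
Import Defs Order.TTheory GRing.Theory Num.Theory numFieldNormedType.Exports.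
Local Open Scope classical_set_scope.
Local Open Scope ring_scope.

(** * Bounded measurable functions *)

Definition bounded_measurable {R : realType} {d : measure_display}
    {T : measurableType d} (f : T -> R) : Prop :=
  measurable_fun [set: T] f /\ exists M : R, forall s, `|f s| <= M.

Definition Ex {R : realType} {d : measure_display} {T : measurableType d}
    (P : probability T R) (f : T -> R) : R :=
  \int[P]_(s in [set: T]) f s.

Section expectation.
Context {R : realType} {d : measure_display} {T : measurableType d}.
Variable P : probability T R.
Implicit Types f g : T -> R.

Lemma bm_cst (c : R) : bounded_measurable (fun _ : T => c).
Proof. by split; [exact: measurable_cst|exists `|c|]. Qed.

Lemma bmD f g : bounded_measurable f -> bounded_measurable g ->
  bounded_measurable (fun s => f s + g s).
Proof.
move=> [mf [M hM]] [mg [N hN]]; split; first exact: measurable_funD.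
by exists (M + N) => s; rewrite (le_trans (ler_normD _ _))// lerD.
Qed.

Lemma bmM f g : bounded_measurable f -> bounded_measurable g ->
  bounded_measurable (fun s => f s * g s).
Proof.
move=> [mf [M hM]] [mg [N hN]]; split; first exact: measurable_funM.
by exists (M * N) => s; rewrite normrM ler_pM.
Qed.

Lemma bmZ (c : R) f : bounded_measurable f ->
  bounded_measurable (fun s => c * f s).
Proof. by move=> bf; apply: bmM => //; exact: bm_cst. Qed.

Lemma bmB f g : bounded_measurable f -> bounded_measurable g ->
  bounded_measurable (fun s => f s - g s).
Proof.
move=> bf bg; have -> : (fun s => f s - g s) = (fun s => f s + (-1) * g s).
  by apply/funext => s; rewrite mulN1r.
by apply: bmD => //; exact: bmZ.
Qed.

Lemma bmX2 f : bounded_measurable f -> bounded_measurable (fun s => f s ^+ 2).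
Proof. by move=> bf; apply: bmM. Qed.

Lemma bm_sum (I : Type) (r : seq I) (F : I -> T -> R) :
  (forall i, bounded_measurable (F i)) ->
  bounded_measurable (fun s => \sum_(i <- r) F i s).
Proof.
move=> bF; elim: r => [|i r IH].
  by under eq_fun do rewrite big_nil; exact: bm_cst.
by under eq_fun do rewrite big_cons; exact: bmD.
Qed.

Lemma bm_indic (A : set T) : measurable A -> bounded_measurable (\1_A : T -> R).
Proof.
move=> mA; split; first exact: measurable_indic.
by exists 1 => s; rewrite indicE; case: (_ \in _); rewrite ?normr1 ?normr0.
Qed.

Lemma bm_integrable f : bounded_measurable f -> P.-integrable setT (EFin \o f).
Proof.
move=> [mf [M hM]]; apply: measurable_bounded_integrable => //.
  by rewrite -ge0_fin_numE ?fin_num_measure.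
exists M; split; first exact: num_real.
by move=> x Mx s _; apply: le_trans (hM s) (ltW Mx).
Qed.

Lemma Ex_cst (c : R) : Ex P (fun _ => c) = c.
Proof.
rewrite /Ex Rintegral_cst//.
rewrite [X in fine X](_ : _ = 1%E) ?mulr1//; exact: probability_setT.
Qed.

Lemma ExD f g : bounded_measurable f -> bounded_measurable g ->
  Ex P (fun s => f s + g s) = Ex P f + Ex P g.
Proof. by move=> bf bg; rewrite /Ex RintegralD//; exact: bm_integrable. Qed.

Lemma ExZ (c : R) f : bounded_measurable f ->
  Ex P (fun s => c * f s) = c * Ex P f.
Proof. by move=> bf; rewrite /Ex RintegralZl//; exact: bm_integrable. Qed.

Lemma ExB f g : bounded_measurable f -> bounded_measurable g ->
  Ex P (fun s => f s - g s) = Ex P f - Ex P g.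
Proof. by move=> bf bg; rewrite /Ex RintegralB//; exact: bm_integrable. Qed.

Lemma Ex_sum (I : Type) (r : seq I) (F : I -> T -> R) :
  (forall i, bounded_measurable (F i)) ->
  Ex P (fun s => \sum_(i <- r) F i s) = \sum_(i <- r) Ex P (F i).
Proof.
move=> bF; elim: r => [|i r IH].
  by under eq_fun do rewrite big_nil; rewrite Ex_cst big_nil.
under eq_fun do rewrite big_cons.
by rewrite ExD ?IH ?big_cons//; exact: bm_sum.
Qed.

Lemma le_Ex f g : bounded_measurable f -> bounded_measurable g ->
  (forall s, f s <= g s) -> Ex P f <= Ex P g.
Proof. by move=> bf bg fg; apply: le_Rintegral => //; exact: bm_integrable. Qed.

Lemma Ex_ge0 f : (forall s, 0 <= f s) -> 0 <= Ex P f.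
Proof. by move=> f0; apply: Rintegral_ge0. Qed.

Lemma EFin_Ex f : bounded_measurable f ->
  (Ex P f)%:E = (\int[P]_(s in setT) (f s)%:E)%E.
Proof.
move=> bf; rewrite /Ex /Rintegral fineK//.
exact: integrable_fin_num (bm_integrable _ bf).
Qed.

Lemma Ex_indic (A : set T) : measurable A -> (Ex P \1_A)%:E = P A.
Proof. by move=> mA; rewrite EFin_Ex ?integral_indic ?setIT//; exact: bm_indic. Qed.

Lemma norm_Ex_le f (M : R) : bounded_measurable f ->
  (forall s, `|f s| <= M) -> `|Ex P f| <= M.
Proof.
move=> bf fM; rewrite ler_norml; apply/andP; split.
  rewrite -(Ex_cst (- M)); apply: le_Ex => // [|s]; first exact: bm_cst.
  by have := fM s; rewrite ler_norml => /andP[].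
rewrite -(Ex_cst M); apply: le_Ex => // [|s]; first exact: bm_cst.
by have := fM s; rewrite ler_norml => /andP[].
Qed.

(* Subtracting [(M/2) (1_{f >= 0} - 1_{f < 0})] halves the sup norm. *)
Lemma bm_ind (H : (T -> R) -> Prop) :
  H (fun _ => 0) ->
  (forall f c A, bounded_measurable f -> H f -> measurable A ->
     H (fun s => f s + c * \1_A s)) ->
  (forall f, bounded_measurable f -> (forall e, 0 < e ->
     exists2 g, bounded_measurable g & H g /\ forall s, `|f s - g s| <= e) -> H f) ->
  forall f, bounded_measurable f -> H f.
Proof.
move=> H0 HD Hlim f bf; apply: Hlim => // e e0.
have step (M : R) n : 0 <= M -> forall f : T -> R, bounded_measurable f ->
    (forall s, `|f s| <= M) -> exists2 g, bounded_measurable g &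
      H g /\ forall s, `|f s - g s| <= M / 2 ^+ n.
  move=> M0; elim: n => [|n IH] {bf}f bf fM.
    exists (fun _ => 0); first exact: bm_cst.
    by split => // s; rewrite subr0 expr0 divr1.
  have [g bg [Hg fg]] := IH f bf fM.
  set A := [set s | 0 <= f s - g s].
  have mA : measurable A.
    have [mh _] := bmB _ _ bf bg.
    have := mh measurableT `[0, +oo[%classic (measurable_itv _).
    rewrite setTI; congr measurable; apply/seteqP; split => s /=.
      by rewrite in_itv/= andbT.
    by rewrite in_itv/= andbT.
  set c := M / 2 ^+ n.+1.
  have Ec : M / 2 ^+ n = c *+ 2.
    by rewrite /c exprS invfM; set t := (2 ^+ n)^-1; lra.
  exists (fun s => g s + (2 * c) * \1_A s + (- c) * \1_setT s).
    apply: bmD; first (apply: bmD => //; apply: bmZ; exact: bm_indic).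
    by apply: bmZ; exact: bm_indic.
  split.
    apply: (HD _ _ _) => //; last exact: (HD _ _ _).
    by apply: bmD => //; apply: bmZ; exact: bm_indic.
  move=> s; rewrite !indicE in_setT mulr1.
  have := fg s; rewrite Ec; case: (boolP (s \in A)) => sA.
    move: sA; rewrite inE /A/= => sA; rewrite mulr1 !ler_norml => /andP[? ?].
    by apply/andP; split; lra.
  have {sA} : ~~ (0 <= f s - g s) by move: sA; apply: contra => ?; rewrite inE.
  rewrite -ltNge => sA; rewrite mulr0 !ler_norml => /andP[? ?].
  by apply/andP; split; lra.
have [_ [M fM]] := bf.
have M0 : 0 <= M by apply: le_trans (fM point); exact: normr_ge0.
have [n Mn] : exists n, M / 2 ^+ n <= e.
  exists (Num.bound (M / e)).
  rewrite ler_pdivrMr ?exprn_gt0// mulrC -ler_pdivrMr//.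
  rewrite (le_trans (ltW (archi_boundP (divr_ge0 M0 (ltW e0)))))//.
  by rewrite -natrX ler_nat ltnW// ltn_expl.
have [g bg [Hg fg]] := step M n M0 f bf fM.
by exists g => //; split => // s; rewrite (le_trans (fg s)).
Qed.

End expectation.

(** * Spin configurations *)

Definition set_spin {d : nat} (x : site d) (b : bool) (s : config d) : config d :=
  fun y => if y == x then b else s y.

Definition nbrs {d : nat} (x : site d) : seq (site d) :=
  [seq shift x i 1 | i <- fintype.enum 'I_d] ++ [seq shift x i (-1) | i <- fintype.enum 'I_d].

(** The resampling operator [K_x]: when [pi x] is the conditional probability of a plus at [x], it
    is the conditional expectation of [f] given the other spins. *)
Definition heat_bath {R : realType} {d : nat} (pi : site d -> config d -> R)
    (x : site d) (f : config d -> R) (s : config d) : R :=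
  pi x s * f (set_spin x true s) + (1 - pi x s) * f (set_spin x false s).

(** Equal to [f (flip x s) - f s] up to sign, but free of the spin at [x], so that the heat bath at
    [x] leaves it fixed. *)
Definition diff {R : realType} {d : nat} (x : site d) (f : config d -> R)
    (s : config d) : R :=
  f (set_spin x true s) - f (set_spin x false s).

Section lattice.
Context {d : nat}.
Implicit Types (x y : site d) (s : config d).

Lemma size_nbrs x : size (nbrs x) = (2 * d)%N.
Proof. by rewrite size_cat 2!size_map size_enum_ord mul2n addnn. Qed.

Lemma shift_neq x i (k : int) : k != 0 -> shift x i k != x.
Proof.
apply: contra => /eqP/ffunP/(_ i); rewrite ffunE eqxx => /eqP.
by rewrite -subr_eq0 addrAC subrr add0r.
Qed.

Lemma nbrsP x y : reflect (exists i, y = shift x i 1 \/ y = shift x i (-1))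
  (y \in nbrs x).
Proof.
apply: (iffP idP) => [|[i []->]]; rewrite mem_cat.
- by move=> /orP[] /mapP[i _ ->]; exists i; [left|right].
- by apply/orP; left; apply/mapP; exists i; rewrite ?mem_enum.
- by apply/orP; right; apply/mapP; exists i; rewrite ?mem_enum.
Qed.

Lemma nbrs_neq x y : y \in nbrs x -> y != x.
Proof. by move=> /nbrsP[i [] ->]; rewrite shift_neq. Qed.

Lemma set_spinE x b s : set_spin x b s x = b.
Proof. by rewrite /set_spin eqxx. Qed.

Lemma set_spin_id x s : set_spin x (s x) s = s.
Proof. by apply/funext => y; rewrite /set_spin; case: eqP => [->|]. Qed.

Lemma set_spinK x b b' s : set_spin x b (set_spin x b' s) = set_spin x b s.
Proof. by apply/funext => y; rewrite /set_spin; case: eqP. Qed.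

Lemma set_spinC x y b b' s : x != y ->
  set_spin x b (set_spin y b' s) = set_spin y b' (set_spin x b s).
Proof.
move=> xy; apply/funext => z; rewrite /set_spin.
by case: (eqVneq z x) => [->|//]; rewrite (negbTE xy).
Qed.

Lemma flipE x s : flip x s = set_spin x (~~ s x) s.
Proof. by []. Qed.

(** The map overwrites the spin at [x]: a generator at [x] pulls back to everything or nothing, any
    other generator to itself, and preimages respect complements and countable unions. *)
Lemma set_spin_off_site x b (A : set (Omega d)) : measurable A ->
  off_site_sets x (set_spin x b @^-1` A).
Proof.
have sO : sigma_algebra [set: config d] (off_site_sets x).
  exact: smallest_sigma_algebra.
move: A; apply: smallest_sub; first split => [|A hA|F hF].
- by rewrite /= preimage_set0; case: sO.
- by rewrite /= setTD preimage_setC -setTD; case: sO => _ + _; exact.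
- by rewrite /= preimage_bigcup; case: sO => _ _; exact.
move=> A [y [b' ->]]; rewrite /=.
have [->|yx] := eqVneq y x.
  have [->|bb] := eqVneq b b'.
    rewrite (_ : _ @^-1` _ = setT); last first.
      by apply/seteqP; split => s //= _; rewrite set_spinE.
    rewrite -(setD0 setT); case: sO => + + _.
    by move=> h0 hD; exact: hD.
  rewrite (_ : _ @^-1` _ = set0); first by case: sO.
  by apply/seteqP; split => s //=; rewrite set_spinE => /eqP; rewrite (negbTE bb).
rewrite (_ : _ @^-1` _ = [set s | s y = b']).
  by apply: sub_gen_smallest; exists y, b'; split => //; exact/eqP.
by apply/seteqP; split => s /=; rewrite /set_spin (negbTE yx).
Qed.

Lemma off_site_measurable x (A : set (Omega d)) :
  off_site_sets x A -> measurable A.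
Proof.
move: A; apply: smallest_sub; first exact: smallest_sigma_algebra.
by move=> A [y [b [_ ->]]]; apply: sub_gen_smallest; exists y, b.
Qed.

Lemma measurable_set_spin x b :
  measurable_fun [set: Omega d] (set_spin x b : Omega d -> Omega d).
Proof.
move=> _ A mA; rewrite setTI.
exact: (off_site_measurable _ _ (set_spin_off_site _ _ _ mA)).
Qed.

Lemma measurable_coord y b : measurable ([set s : Omega d | s y = b]).
Proof. by apply: sub_gen_smallest; exists y, b. Qed.

Lemma bm_set_spin {R : realType} x b (f : Omega d -> R) :
  bounded_measurable f ->
  bounded_measurable (fun s : Omega d => f (set_spin x b s)).
Proof.
move=> [mf [M hM]]; split; last by exists M => s.
apply: (measurableT_comp mf); exact: measurable_set_spin.
Qed.

End lattice.

(** A duplicate-free [T] meets [V] in at most [size V] elements. *)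
Lemma sum_mem_le {R : realType} {I : eqType} (T V : seq I) (w : I -> R) (B : R) :
  uniq T -> 0 <= B -> (forall y, y \in V -> w y <= B) ->
  \sum_(y <- T) (y \in V)%:R * w y <= (size V)%:R * B.
Proof.
move=> uT B0 wB.
apply: (@le_trans _ _ (\sum_(y <- T) (y \in V)%:R * B)).
  apply: ler_sum => y _; case: (boolP (y \in V)) => yV; last by rewrite !mul0r.
  by rewrite !mul1r wB.
rewrite -mulr_suml ler_wpM2r// -natr_sum ler_nat.
rewrite (_ : \sum_(i <- T) _ = size [seq y <- T | y \in V])%N.
  apply: uniq_leq_size; first exact: filter_uniq.
  by move=> y; rewrite mem_filter => /andP[].
rewrite size_filter -sum1_count [RHS]big_mkcond.
by apply: eq_bigr => y _ /=; case: (y \in V).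
Qed.

(* The hypothesis says that [k |-> e_(k+1) - q e_k] grows at least like [q ^ k],
   so a positive term would force [e_k] to grow like [k q ^ k]. *)
Lemma log_convex_decay {R : realType} (e : nat -> R) (q C : R) : 0 < q ->
  (forall m, 0 <= q ^+ 2 * e m - 2 * q * e m.+1 + e m.+2) ->
  (forall m, e m <= C * q ^+ m) ->
  forall m, e m.+1 <= q * e m.
Proof.
move=> q0 conv eC m; rewrite -subr_le0 leNgt; apply/negP.
set D := e m.+1 - q * e m => D0.
have hD k : q ^+ k * D <= e (m + k).+1 - q * e (m + k)%N.
  elim: k => [|k IH]; first by rewrite addn0 mul1r.
  rewrite addnS exprS -mulrA; have := conv (m + k)%N.
  have : q * (q ^+ k * D) <= q * (e (m + k).+1 - q * e (m + k)%N).
    by rewrite ler_wpM2l// ltW.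
  move: (q * (q ^+ k * D)) => Z; nra.
have he k : q ^+ k * (q * e m + k%:R * D) <= q * e (m + k)%N.
  elim: k => [|k IH]; first by rewrite addn0 mul1r mul0r addr0.
  have h1 := hD k; have {}IH : q * (q ^+ k * (q * e m + k%:R * D)) <=
      q * (q * e (m + k)%N) by rewrite ler_wpM2l// ltW.
  have {}h1 : q * (q ^+ k * D) <= q * (e (m + k).+1 - q * e (m + k)%N).
    by rewrite ler_wpM2l// ltW.
  rewrite addnS -natr1 exprS; apply: le_trans
    (_ : _ <= q * (q ^+ k * (q * e m + k%:R * D)) + q * (q ^+ k * D)) _.
    by rewrite le_eqVlt; apply/orP; left; apply/eqP; ring.
  apply: le_trans (lerD IH h1) _.
  by rewrite le_eqVlt; apply/orP; left; apply/eqP; ring.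
have bnd k : k%:R * D <= q * (C * q ^+ m) - q * e m.
  have qk : 0 < q ^+ k by exact: exprn_gt0.
  rewrite lerBrDl -(ler_pM2l qk) (le_trans (he k))//.
  rewrite (le_trans (ler_wpM2l (ltW q0) (eC _)))// exprD.
  by rewrite le_eqVlt; apply/orP; left; apply/eqP; ring.
set B := q * (C * q ^+ m) - q * e m in bnd.
have B0 : 0 <= B by have := bnd 0%N; rewrite mul0r.
have := bnd (Num.bound (B / D)); rewrite -ler_pdivlMr// leNgt => /negP; apply.
by apply: archi_boundP; rewrite divr_ge0// ltW.
Qed.

(** * Glauber dynamics *)
Section specification.
Context {R : realType} {d : nat}.
Variables (pi : site d -> config d -> R) (P : probability (Omega d) R).
Hypothesis pi01 : forall x s, 0 <= pi x s <= 1.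
Hypothesis pi_meas : forall x, measurable_fun [set: Omega d] (pi x : Omega d -> R).
Hypothesis pi_loc : forall x s s',
  (forall y, y \in nbrs x -> s y = s' y) -> pi x s = pi x s'.
Hypothesis pi_cond : forall (x : site d) (B : set (Omega d)), off_site_sets x B ->
  (P ([set s : Omega d | s x = true] `&` B) = \int[P]_(s in B) (pi x s)%:E)%E.
Local Notation bm := (@bounded_measurable R _ (Omega d)).

Lemma pi_bm x : bm (pi x).
Proof.
split; first exact: pi_meas.
by exists 1 => s; have /andP[? ?] := pi01 x s; rewrite ger0_norm.
Qed.

Lemma pi_set_spin x b s : pi x (set_spin x b s) = pi x s.
Proof.
by apply: pi_loc => y /nbrs_neq /negbTE yx; rewrite /set_spin yx.
Qed.

Lemma heat_bm x f : bm f -> bm (heat_bath pi x f).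
Proof.
move=> bf; apply: bmD; apply: bmM; rewrite ?pi_bm//; try exact: bm_set_spin.
- exact: pi_bm.
- by apply: bmB; [exact: bm_cst|exact: pi_bm].
Qed.

Lemma diff_bm x f : bm f -> bm (diff x f).
Proof. by move=> bf; apply: bmB; exact: bm_set_spin. Qed.

(** [f (set_spin x b s)] depends only on the spins off [x], and given those a plus at [x] has
    probability [pi x]. On indicators this is [pi_cond]; [bm_ind] extends it. *)
Lemma Ex_plus_sub_pi x b (f : Omega d -> R) : bm f ->
  Ex P (fun s => (\1_[set s : Omega d | s x = true] s - pi x s) *
                 f (set_spin x b s)) = 0.
Proof.
set C := [set s : Omega d | s x = true].
have mC : measurable C by exact: measurable_coord.
have bk : bm (fun s => \1_C s - pi x s).
  by apply: bmB; [exact: bm_indic|exact: pi_bm].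
have k1 s : `|\1_C s - pi x s| <= 1.
  have /andP[? ?] := pi01 x s; rewrite indicE ler_norml.
  by case: (_ \in _) => /=; apply/andP; split; lra.
move: f; apply: bm_ind.
- by rewrite -[RHS](Ex_cst P 0); congr Ex; apply/funext => s; rewrite mulr0.
- move=> f c A bf fE mA.
  set B : set (Omega d) := set_spin x b @^-1` A.
  have oB : off_site_sets x B by exact: set_spin_off_site.
  have mB : measurable B by exact: off_site_measurable oB.
  have bA : bm (fun s => (\1_C s - pi x s) * (c * \1_A (set_spin x b s))).
    by apply: bmM => //; apply: bmZ; apply: bm_set_spin; exact: bm_indic.
  rewrite [X in Ex P X](_ : _ = fun s => (\1_C s - pi x s) * f (set_spin x b s) +
    (\1_C s - pi x s) * (c * \1_A (set_spin x b s))); last first.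
    by apply/funext => s; rewrite mulrDr.
  rewrite ExD//; last by apply: bmM => //; exact: bm_set_spin.
  rewrite fE add0r.
  (* [\1_A] after [set_spin x b] is the indicator of the off-site set [B]. *)
  have -> : (fun s => (\1_C s - pi x s) * (c * \1_A (set_spin x b s))) =
            (fun s => c * (\1_(C `&` B) s - pi x s * \1_B s)).
    apply/funext => s; rewrite !indicE in_setI.
    have -> : (set_spin x b s \in A) = (s \in B) by apply/idP/idP; rewrite !inE.
    by case: (s \in C); case: (s \in B) => /=; ring.
  have bpB : bm (fun s => pi x s * \1_B s) by apply: bmM; [exact: pi_bm|exact: bm_indic].
  rewrite ExZ; last by apply: bmB => //; exact: bm_indic (measurableI _ _ mC mB).
  rewrite ExB//; last exact: bm_indic (measurableI _ _ mC mB).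
  apply/eqP; rewrite mulf_eq0 subr_eq0; apply/orP; right; apply/eqP.
  apply: EFin_inj; rewrite Ex_indic ?EFin_Ex//; last exact: measurableI.
  rewrite pi_cond// integral_mkcond; apply: eq_integral => s _.
  by rewrite patchE indicE; case: (s \in B); rewrite ?mulr1 ?mulr0.
(* As [|1_C - pi| <= 1], a uniform error [e] in [f] costs at most [e] in the expectation. *)
- move=> f bf lim; apply/eqP; rewrite -normr_le0; apply/ler_addgt0Pr => e e0.
  have [g bg [gE fg]] := lim e e0; rewrite add0r.
  rewrite -[X in `|X|]subr0 -gE -ExB; try by apply: bmM => //; exact: bm_set_spin.
  apply: norm_Ex_le.
    by apply: bmB; apply: bmM => //; exact: bm_set_spin.
  by move=> s; rewrite -mulrBr normrM -[e]mul1r ler_pM.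
Qed.

(** At [s], [f] takes its value for the spin actually present, so [f - K_x f] is [1_C - pi] times a
    difference of two functions that ignore the spin at [x]. *)
Lemma Ex_heat x f : bm f -> Ex P (heat_bath pi x f) = Ex P f.
Proof.
move=> bf; apply/esym/eqP; rewrite -subr_eq0 -ExB//; last exact: heat_bm.
set C := [set s : Omega d | s x = true].
have bk : bm (fun s => \1_C s - pi x s).
  by apply: bmB; [apply: bm_indic; exact: measurable_coord|exact: pi_bm].
have -> : (fun s => f s - heat_bath pi x f s) =
    (fun s => (\1_C s - pi x s) * f (set_spin x true s) -
              (\1_C s - pi x s) * f (set_spin x false s)).
  apply/funext => s; rewrite /heat_bath indicE.
  have -> : (s \in C) = s x by apply/idP/idP; rewrite inE.
  by rewrite -{1}(set_spin_id x s); case: (s x) => /=; ring.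
rewrite ExB ?Ex_plus_sub_pi ?subrr//; by apply: bmM => //; exact: bm_set_spin.
Qed.

(* Pointwise, the heat bath of [u (v - heat v)] is [pi (1 - pi) diff u diff v]. *)
Lemma Ex_mul_sub_heat x u v : bm u -> bm v ->
  Ex P (fun s => u s * (v s - heat_bath pi x v s)) =
  Ex P (fun s => pi x s * (1 - pi x s) * diff x u s * diff x v s).
Proof.
move=> bu bv; rewrite -(Ex_heat x); last first.
  by apply: bmM => //; apply: bmB => //; exact: heat_bm.
congr Ex; apply/funext => s.
by rewrite /heat_bath /diff !set_spinK !pi_set_spin; ring.
Qed.

(** * The Glauber operator on a finite set of sites and its quadratic form *)

Variable L : seq (site d).
Variables c tau : R.
Hypothesis L_uniq : uniq L.
Hypothesis pi_osc : forall x y s, `|pi x (flip y s) - pi x s| <= c.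
Hypothesis c_ge0 : 0 <= c.
Hypothesis tau_gt0 : 0 < tau.
Hypothesis tau_size : tau * (size L)%:R <= 1.

(** The operator [K]: at most one site is resampled per step, each site of [L] with probability
    [tau]. *)
Definition glauber (f : config d -> R) (s : config d) : R :=
  f s - tau * \sum_(x <- L) (f s - heat_bath pi x f s).

(** Up to the factor [tau], the inner product of [f] with [g - glauber g]; see
    [Ex_mul_sub_glauber]. *)
Definition dform (f g : config d -> R) : R :=
  \sum_(x <- L) Ex P (fun s : Omega d =>
    pi x s * (1 - pi x s) * diff x f s * diff x g s).

(** For [tau * size L <= 1] this is a convex combination of the identity and the heat baths, whence
    positivity and the averaging of oscillations. *)
Lemma glauberE f s :
  glauber f s = (1 - tau * (size L)%:R) * f s +
                tau * \sum_(x <- L) heat_bath pi x f s.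
Proof.
rewrite /glauber sumrB big_const_seq count_predT iter_addr_0 -mulr_natr; ring.
Qed.

Lemma glauberB f g : glauber (fun s => f s - g s) =
  fun s => glauber f s - glauber g s.
Proof.
apply/funext => s; rewrite !glauberE.
rewrite (_ : \sum_(x <- L) heat_bath pi x (fun s => f s - g s) s =
  \sum_(x <- L) heat_bath pi x f s - \sum_(x <- L) heat_bath pi x g s); first by ring.
by rewrite -sumrB; apply: eq_bigr => x _; rewrite /heat_bath; ring.
Qed.

Lemma glauberZ a f : glauber (fun s => a * f s) = fun s => a * glauber f s.
Proof.
apply/funext => s; rewrite !glauberE.
rewrite (_ : \sum_(x <- L) heat_bath pi x (fun s => a * f s) s =
  a * \sum_(x <- L) heat_bath pi x f s); first by ring.
by rewrite mulr_sumr; apply: eq_bigr => x _; rewrite /heat_bath; ring.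
Qed.

Lemma glauber_cst a : glauber (fun=> a) = fun=> a.
Proof.
apply/funext => s; rewrite /glauber big1 ?mulr0 ?subr0// => x _.
by rewrite /heat_bath; ring.
Qed.

Lemma heat_ge0 x f s : (forall s, 0 <= f s) -> 0 <= heat_bath pi x f s.
Proof.
move=> f0; have /andP[? ?] := pi01 x s.
by rewrite addr_ge0// mulr_ge0// subr_ge0.
Qed.

Lemma glauber_ge0 f s : (forall s, 0 <= f s) -> 0 <= glauber f s.
Proof.
move=> f0; rewrite glauberE addr_ge0//; first by rewrite mulr_ge0// subr_ge0.
by apply: mulr_ge0; [exact: ltW|apply: sumr_ge0 => x _; exact: heat_ge0].
Qed.

Lemma glauber_bm f : bm f -> bm (glauber f).
Proof.
move=> bf; apply: bmB => //; apply: bmZ; apply: bm_sum => x.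
by apply: bmB => //; exact: heat_bm.
Qed.

Lemma iter_glauber_bm m f : bm f -> bm (iter m glauber f).
Proof. by move=> bf; elim: m => //= m; exact: glauber_bm. Qed.

Lemma Ex_glauber f : bm f -> Ex P (glauber f) = Ex P f.
Proof.
move=> bf; have bF x : bm (fun s => f s - heat_bath pi x f s).
  by apply: bmB => //; exact: heat_bm.
rewrite ExB//; last by apply: bmZ; exact: bm_sum.
rewrite ExZ; last exact: bm_sum.
rewrite Ex_sum// big1 ?mulr0 ?subr0// => x _.
by rewrite ExB ?Ex_heat ?subrr//; exact: heat_bm.
Qed.

Lemma dform_bm x u v : bm u -> bm v ->
  bm (fun s => pi x s * (1 - pi x s) * diff x u s * diff x v s).
Proof.
move=> bu bv; apply: bmM; last exact: diff_bm.
apply: bmM; last exact: diff_bm.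
apply: bmM; first exact: pi_bm.
by apply: bmB; [exact: bm_cst|exact: pi_bm].
Qed.

Lemma dformC u v : dform u v = dform v u.
Proof.
apply: eq_bigr => x _; congr Ex; apply/funext => s; ring.
Qed.

Lemma dform_ge0 u : 0 <= dform u u.
Proof.
apply: sumr_ge0 => x _; apply: Ex_ge0 => s; have /andP[? ?] := pi01 x s.
rewrite -mulrA; apply: mulr_ge0; last by rewrite -expr2 sqr_ge0.
by apply: mulr_ge0; rewrite ?subr_ge0.
Qed.

Lemma Ex_mul_sub_glauber u v : bm u -> bm v ->
  Ex P (fun s => u s * (v s - glauber v s)) = tau * dform u v.
Proof.
move=> bu bv.
have bF x : bm (fun s => u s * (v s - heat_bath pi x v s)).
  by apply: bmM => //; apply: bmB => //; exact: heat_bm.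
rewrite [X in Ex P X](_ : _ = fun s => tau *
    \sum_(x <- L) (u s * (v s - heat_bath pi x v s))); last first.
  apply/funext => s; rewrite -mulr_sumr /glauber; ring.
rewrite ExZ ?Ex_sum//; last exact: bm_sum.
by congr (_ * _); apply: eq_bigr => x _; rewrite Ex_mul_sub_heat.
Qed.

(** [dform] is symmetric, hence so is the bilinear form of [1 - K], and with it that of [K]. *)
Lemma Ex_glauberC u v : bm u -> bm v ->
  Ex P (fun s => u s * glauber v s) = Ex P (fun s => glauber u s * v s).
Proof.
move=> bu bv; have bKu := glauber_bm _ bu; have bKv := glauber_bm _ bv.
have := Ex_mul_sub_glauber u v bu bv; rewrite dformC -Ex_mul_sub_glauber//.
rewrite [X in Ex P X](_ : _ = fun s => u s * v s - u s * glauber v s); last first.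
  by apply/funext => s; ring.
rewrite [X in _ = Ex P X -> _](_ : _ = fun s => u s * v s - glauber u s * v s); last first.
  by apply/funext => s; ring.
by rewrite !ExB; try exact: bmM; move=> /addrI/oppr_inj.
Qed.

(** [K] is self-adjoint and commutes with [1 - K]. Hence [dform] of two iterates of one function
    depends only on the sum of their exponents. *)
Lemma dform_glauber u v : bm u -> bm v ->
  dform u (glauber v) = dform (glauber u) v.
Proof.
move=> bu bv; have bKu := glauber_bm _ bu; have bKv := glauber_bm _ bv.
apply: (mulfI (lt0r_neq0 tau_gt0)); rewrite -!Ex_mul_sub_glauber//.
by rewrite -Ex_glauberC ?glauberB//; exact: bmB.
Qed.

(** Positivity of [dform] at [q u - v]. For iterates two steps apart it becomes the convexity
    hypothesis of [log_convex_decay]. *)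
Lemma dform_quad q u v : bm u -> bm v ->
  0 <= q ^+ 2 * dform u u - 2 * q * dform u v + dform v v.
Proof.
move=> bu bv; have := dform_ge0 (fun s => q * u s - v s).
rewrite {1}/dform (eq_bigr (fun x =>
   q ^+ 2 * Ex P (fun s : Omega d => pi x s * (1 - pi x s) * diff x u s * diff x u s)
   - 2 * q * Ex P (fun s : Omega d => pi x s * (1 - pi x s) * diff x u s * diff x v s)
   + Ex P (fun s : Omega d => pi x s * (1 - pi x s) * diff x v s * diff x v s))).
  by rewrite big_split /= sumrB -!mulr_sumr.
move=> x _; rewrite -!ExZ; try exact: dform_bm.
rewrite -ExB; try (apply: bmZ; exact: dform_bm).
rewrite -ExD; last exact: dform_bm; last first.
  by apply: bmB; apply: bmZ; exact: dform_bm.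
by congr Ex; apply/funext => s; rewrite /diff; ring.
Qed.

(** Jensen's inequality: [K] is positive and fixes constants, so it is applied to [(f - a) ^+ 2]
    with [a] frozen at the value of [K f] at [s]. *)
Lemma sqr_glauber_le f s : glauber f s ^+ 2 <= glauber (fun s => f s ^+ 2) s.
Proof.
set a := glauber f s; rewrite -subr_ge0.
have := glauber_ge0 (fun s => (f s - a) ^+ 2) s (fun s => sqr_ge0 _).
rewrite (_ : (fun s => _) =
    (fun s => (f s ^+ 2 - (2 * a) * f s) - (fun=> - a ^+ 2) s)); last first.
  by apply/funext => t; ring.
rewrite 2!glauberB glauberZ glauber_cst -/a => /le_trans; apply.
by rewrite le_eqVlt; apply/orP; left; apply/eqP; ring.
Qed.

Lemma Ex_sqr_glauber_le f : bm f ->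
  Ex P (fun s => glauber f s ^+ 2) <= Ex P (fun s => f s ^+ 2).
Proof.
move=> bf; rewrite -(Ex_glauber (fun s => f s ^+ 2)); last exact: bmX2.
apply: le_Ex => [||s]; [apply: bmX2; exact: glauber_bm| |exact: sqr_glauber_le].
by apply: glauber_bm; exact: bmX2.
Qed.

Lemma Ex_sqr_iter_le m f : bm f ->
  Ex P (fun s => iter m glauber f s ^+ 2) <= Ex P (fun s => f s ^+ 2).
Proof.
move=> bf; elim: m => // m; apply: le_trans.
exact: Ex_sqr_glauber_le (iter_glauber_bm _ _ bf).
Qed.

(** * Propagation of one-site oscillations *)

Definition osc_le (f : config d -> R) (u : site d -> R) : Prop :=
  forall y s, `|f (flip y s) - f s| <= u y.

(** Dobrushin's update: resampling [y] erases its own oscillation, while resampling a site [x] next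
    to [y] passes on at most [c] times the oscillation at [x]. *)
Definition osc_step (u : site d -> R) (y : site d) : R :=
  (1 - tau * (y \in L)%:R) * u y +
  tau * (c * \sum_(x <- L) (y \in nbrs x)%:R * u x).

(** For [x = y] the heat bath ignores the flipped spin. Otherwise the flip acts on [f], and also on
    [pi x] when [y] is a neighbour of [x]. *)
Lemma osc_heat f u x y s : osc_le f u ->
  `|heat_bath pi x f (flip y s) - heat_bath pi x f s| <=
  (1 - (x == y)%:R) * u y + c * ((y \in nbrs x)%:R * u x).
Proof.
move=> fu; have u0 z : 0 <= u z by apply: le_trans (fu z s); exact: normr_ge0.
have [<-|xy] := eqVneq x y.
  rewrite subrr mul0r add0r /heat_bath flipE !set_spinK pi_set_spin subrr normr0.
  by rewrite mulr_ge0// mulr_ge0.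
rewrite subr0 mul1r.
have E b : set_spin x b (flip y s) = flip y (set_spin x b s).
  rewrite !flipE set_spinC//; congr (set_spin _ _ _).
  by rewrite /set_spin eq_sym (negbTE xy).
rewrite /heat_bath !E.
set p := pi x s; set p' := pi x (flip y s).
set a := f (set_spin x true s); set b := f (set_spin x false s).
set a' := f (flip y _); set b' := f (flip y _).
have /andP[p0 p1] : 0 <= p <= 1 by exact: pi01.
(* The first two terms average the effect on [f]; the last is the change of probability times the
   oscillation at [x]. *)
have -> : p' * a' + (1 - p') * b' - (p * a + (1 - p) * b) =
  p * (a' - a) + (1 - p) * (b' - b) + (p' - p) * (a' - b') by ring.
have ha : `|a' - a| <= u y by exact: fu.
have hb : `|b' - b| <= u y by exact: fu.
have hab : `|a' - b'| <= u x.
  rewrite /a' /b' -!E -(set_spinK x true false) -[true]/(~~ false).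
  rewrite -{1}(set_spinE x false (flip y s)); exact: fu.
rewrite (le_trans (ler_normD _ _))// lerD//.
  have q0 : 0 <= 1 - p by rewrite subr_ge0.
  rewrite (le_trans (ler_normD _ _))// !normrM (ger0_norm p0) (ger0_norm q0).
  have -> : u y = p * u y + (1 - p) * u y by ring.
  by apply: lerD; apply: ler_wpM2l.
rewrite normrM mulrA; apply: ler_pM => //.
case: (boolP (y \in nbrs x)) => yx; first by rewrite mulr1; exact: pi_osc.
rewrite mulr0 /p' /p (pi_loc _ _ s) ?subrr ?normr0// => z zx.
by rewrite /flip; case: eqP => // zy; move: zx; rewrite zy (negbTE yx).
Qed.

Lemma osc_glauber f u : osc_le f u -> osc_le (glauber f) (osc_step u).
Proof.
move=> fu y s; rewrite !glauberE.
set N := 1 - _; have N0 : 0 <= N by rewrite subr_ge0.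
rewrite opprD addrACA -!mulrBr -sumrB.
rewrite (le_trans (ler_normD _ _))// !normrM (ger0_norm N0) (gtr0_norm tau_gt0).
have H : `|\sum_(x <- L) (heat_bath pi x f (flip y s) - heat_bath pi x f s)| <=
    ((size L)%:R - (y \in L)%:R) * u y + c * \sum_(x <- L) (y \in nbrs x)%:R * u x.
  rewrite (le_trans (ler_norm_sum _ _ _))//.
  rewrite (le_trans (ler_sum _ (fun x _ => osc_heat _ _ x y s fu)))//.
  rewrite big_split /= -mulr_suml sumrB -mulr_sumr.
  rewrite big_const_seq count_predT iter_addr_0 -natr_sum.
  rewrite (_ : (\sum_(x <- L) (x == y) = (y \in L))%N)// -count_uniq_mem//.
  by rewrite -sum1_count [RHS]big_mkcond; apply: eq_bigr => x _ /=; case: eqP.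
rewrite /osc_step (le_trans (lerD (ler_wpM2l N0 (fu y s)) (ler_wpM2l (ltW tau_gt0) H)))//.
by rewrite le_eqVlt; apply/orP; left; apply/eqP; rewrite /N; ring.
Qed.

Lemma osc_step_ge0 u : (forall y, 0 <= u y) -> tau <= 1 -> forall y, 0 <= osc_step u y.
Proof.
move=> u0 t1 y; rewrite addr_ge0// mulr_ge0//.
- by rewrite subr_ge0; case: (_ \in _); rewrite ?mulr1 ?mulr0.
- exact: ltW.
- by rewrite mulr_ge0// sumr_ge0// => x _; rewrite mulr_ge0.
Qed.

(** Mass balance: each [x] in [L] loses [tau * w x * u x] and gives each of its [2 d] neighbours at
    most [tau * c * rho * w x * u x] in weighted mass. *)
Lemma osc_step_sum T (w u : site d -> R) (rho : R) :
  uniq T -> {subset L <= T} -> (forall y, 0 <= w y) -> 0 <= rho ->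
  (forall x y, x \in L -> y \in nbrs x -> w y <= rho * w x) ->
  (forall y, 0 <= u y) ->
  \sum_(y <- T) w y * osc_step u y <=
  \sum_(y <- T) w y * u y -
  tau * (1 - c * (2 * d)%:R * rho) * \sum_(x <- L) w x * u x.
Proof.
move=> uT LT w0 rho0 wrho u0.
have -> : \sum_(y <- T) w y * osc_step u y = \sum_(y <- T) w y * u y -
    tau * \sum_(y <- T) (y \in L)%:R * (w y * u y) +
    tau * c * \sum_(y <- T) \sum_(x <- L) (y \in nbrs x)%:R * w y * u x.
  transitivity (\sum_(y <- T) (w y * u y - tau * ((y \in L)%:R * (w y * u y)) +
    tau * c * \sum_(x <- L) (y \in nbrs x)%:R * w y * u x)); last first.
    by rewrite big_split /= sumrB -!mulr_sumr.
  apply: eq_bigr => y _ /=.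
  rewrite /osc_step (_ : \sum_(x <- L) (y \in nbrs x)%:R * w y * u x =
    w y * \sum_(x <- L) (y \in nbrs x)%:R * u x); first by ring.
  by rewrite mulr_sumr; apply: eq_bigr => x _; ring.
have -> : \sum_(y <- T) (y \in L)%:R * (w y * u y) = \sum_(y <- L) w y * u y.
  transitivity (\sum_(y <- [seq y <- T | y \in L]) w y * u y).
    rewrite big_filter [RHS]big_mkcond; apply: eq_bigr => y _.
    by case: (y \in L); rewrite ?mul1r ?mul0r.
  apply/perm_big/uniq_perm => // [|y]; first exact: filter_uniq.
  by rewrite mem_filter; case: (boolP (y \in L)) => // /LT ->.
(* The transferred mass is counted by its source [x] instead of its target [y]. *)
rewrite exchange_big /=.
have H : \sum_(x <- L) \sum_(y <- T) (y \in nbrs x)%:R * w y * u x <=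
    (2 * d)%:R * rho * \sum_(x <- L) w x * u x.
  rewrite mulr_sumr big_seq [leRHS]big_seq; apply: ler_sum => x xL.
  rewrite -mulr_suml mulrA ler_wpM2r// -mulrA.
  rewrite -(size_nbrs x).
  by apply: sum_mem_le => // [|y]; [exact: mulr_ge0|exact: wrho].
have {}H := ler_wpM2l (mulr_ge0 (ltW tau_gt0) c_ge0) H.
rewrite -addrA lerD2l (le_trans (lerD (lexx _) H))//.
by rewrite le_eqVlt; apply/orP; left; apply/eqP; ring.
Qed.

(** * Geometric decay of the form and of the L2 norm *)

Hypothesis tau_lt1 : tau < 1.
Hypothesis c_small : c * (2 * d)%:R < 1.

(** The factor by which one step contracts the total oscillation over [L]: [osc_step_sum] with
    constant weight one. *)
Definition rate : R := 1 - tau * (1 - c * (2 * d)%:R).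

Lemma rate_gt0 : 0 < rate.
Proof.
have : 0 <= tau * (c * (2 * d)%:R) by rewrite mulr_ge0 ?mulr_ge0// ltW.
rewrite /rate mulrBr mulr1; move: (tau * (c * _)) tau_lt1 => z; lra.
Qed.

Lemma rate_le1 : rate <= 1.
Proof. by rewrite /rate gerBl mulr_ge0 ?subr_ge0// ltW. Qed.

Lemma iter_osc_step_ge0 u m : (forall y, 0 <= u y) ->
  forall y, 0 <= iter m osc_step u y.
Proof. by move=> u0; elim: m => //= m IH; apply: osc_step_ge0 => //; exact: ltW. Qed.

Lemma osc_iter f u m : osc_le f u ->
  osc_le (iter m glauber f) (iter m osc_step u).
Proof. by move=> fu; elim: m => //= m; exact: osc_glauber. Qed.

Lemma iter_osc_step_sum u m : (forall y, 0 <= u y) ->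
  \sum_(x <- L) iter m osc_step u x <= rate ^+ m * \sum_(x <- L) u x.
Proof.
move=> u0; elim: m => [|m IH]; first by rewrite mul1r.
have E (F : site d -> R) : \sum_(x <- L) 1 * F x = \sum_(x <- L) F x.
  by apply: eq_bigr => x _; rewrite mul1r.
have w1 (x y : site d) : x \in L -> y \in nbrs x -> (1 : R) <= 1 * 1 by rewrite mulr1.
have := osc_step_sum L (fun=> 1) (iter m osc_step u) 1 L_uniq (fun _ h => h)
  (fun=> ler01) ler01 w1 (iter_osc_step_ge0 _ _ u0).
rewrite !E mulr1.
move=> H; apply: (le_trans H); rewrite exprS -[leRHS]mulrA.
apply: le_trans _ (ler_wpM2l (ltW rate_gt0) IH).
by rewrite le_eqVlt; apply/orP; left; apply/eqP; rewrite /rate; ring.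
Qed.

(** [pi (1 - pi) <= 1] and [|diff x f| <= u x]; a sum of squares of nonnegative numbers is at most
    the square of their sum. *)
Lemma dform_osc_le f u : bm f -> osc_le f u -> dform f f <= (\sum_(x <- L) u x) ^+ 2.
Proof.
move=> bf fu; have u0 y : 0 <= u y by apply: le_trans (fu y point); exact: normr_ge0.
apply: (@le_trans _ _ (\sum_(x <- L) u x ^+ 2)).
  apply: ler_sum => x _; rewrite -[leRHS](Ex_cst P).
  apply: le_Ex => [||s]; [exact: dform_bm|exact: bm_cst|].
  have /andP[p0 p1] := pi01 x s.
  rewrite -mulrA -expr2 -[leRHS]mul1r; apply: ler_pM.
  - by apply: mulr_ge0; rewrite ?subr_ge0.
  - exact: sqr_ge0.
  - by rewrite -[leRHS]mulr1 ler_pM// ?subr_ge0// gerBl.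
  - rewrite -[leLHS]real_normK ?num_real// ler_sqr ?nnegrE//.
    rewrite /diff -(set_spinK x true false) -[true]/(~~ false).
    by rewrite -{1}(set_spinE x false s); exact: fu.
elim: L => [|x l IH]; first by rewrite !big_nil expr0n.
rewrite !big_cons sqrrD -addrA lerD2l (le_trans IH)// lerDr.
by rewrite mulrn_wge0// mulr_ge0// sumr_ge0.
Qed.

(** Each step loses at most [2 * tau * e k] of squared norm, and [e k] decays like [q ^+ k] with
    constant one, so the losses sum to a bound free of [m] and of the size of [L]. *)
Lemma L2_decay_le f m : bm f ->
  (1 - c * (2 * d)%:R) *
    (Ex P (fun s => f s ^+ 2) - Ex P (fun s => iter m glauber f s ^+ 2)) <=
  2 * dform f f.
Proof.
move=> bf; pose v k := iter k glauber f; pose e k := dform (v k) (v k).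
have bv k : bm (v k) by exact: iter_glauber_bm.
have [_ [M fM]] := bf.
have M0 : 0 <= M by apply: le_trans (fM point); exact: normr_ge0.
have fu : osc_le f (fun=> 2 * M).
  move=> y s; rewrite (le_trans (ler_normB _ _))//.
  by rewrite mulr2n mulrDl !mul1r lerD.
(* The form is quadratic in the oscillations, so the rate enters squared. The prefactor [S ^+ 2]
   depends on [f] and [L]; [log_convex_decay] removes it. *)
set q := rate ^+ 2; set S := \sum_(x <- L) (2 * M).
have q0 : 0 < q by exact: exprn_gt0 rate_gt0.
have q1 : q <= rate by rewrite /q expr2 ger_pMl ?rate_gt0 ?rate_le1.
have eM k : e k <= S ^+ 2 * q ^+ k.
  rewrite (le_trans (dform_osc_le _ _ (bv k) (osc_iter _ _ k fu)))//.
  rewrite -exprM mulnC exprM -exprMn ler_sqr ?nnegrE.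
  - by rewrite [leRHS]mulrC; apply: iter_osc_step_sum => _; exact: mulr_ge0.
  - by apply: sumr_ge0 => x _; apply: iter_osc_step_ge0 => _; exact: mulr_ge0.
  - rewrite mulr_ge0// ?exprn_ge0 ?(ltW rate_gt0)//.
    by apply: sumr_ge0 => x _; exact: mulr_ge0.
have dec := log_convex_decay e q (S ^+ 2) q0 _ eM.
have {}dec k : e k.+1 <= q * e k.
  apply: dec => j.
  (* Moving one [K] from the right slot to the left produces the middle term of the convexity
     inequality. *)
  have <- : dform (v j) (v j.+2) = e j.+1 := dform_glauber _ _ (bv j) (bv j.+1).
  exact: dform_quad.
have e0 k : 0 <= e k by exact: dform_ge0.
have geo k : e k <= q ^+ k * e 0%N.
  elim: k => [|k IH]; first by rewrite mul1r.
  by rewrite (le_trans (dec k))// exprS -mulrA ler_wpM2l// ltW.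
pose a k := Ex P (fun s => v k s ^+ 2).
have step k : a k - a k.+1 <= tau * (2 * e k).
  (* Difference of squares: [v k - v k.+1] is [(1 - K) (v k)], paired with [v k + v k.+1]. *)
  have -> : a k - a k.+1 = tau * (e k + dform (v k.+1) (v k)).
    rewrite mulrDr -!Ex_mul_sub_glauber// -ExD; last 2 first.
    - by apply: bmM => //; exact: bmB (bv k) (bv k.+1).
    - by apply: bmM => //; exact: bmB (bv k) (bv k.+1).
    rewrite -ExB; try exact: bmX2.
    by congr Ex; apply/funext => s; rewrite /v /=; ring.
  rewrite ler_pM2l// mulr2n mulrDl !mul1r lerD2l.
  (* At [q = 1], twice the mixed term is at most [e k + e k.+1], hence at most [2 * e k]. *)
  have := dform_quad 1 (v k) (v k.+1) (bv _) (bv _).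
  rewrite -/(e k) -/(e k.+1) dformC.
  have : e k.+1 <= e k.
    by rewrite (le_trans (dec k))// ler_piMl//; exact: le_trans q1 rate_le1.
  rewrite expr1n; lra.
(* The right side is [1 - q] times the geometric sum of the first [m] one-step bounds. *)
have tel : (1 - q) * (a 0%N - a m) <= tau * (2 * e 0%N) * (1 - q ^+ m).
  elim: (m) => [|k IH]; first by rewrite subrr mulr0 expr0 subrr mulr0.
  have -> : a 0%N - a k.+1 = (a 0%N - a k) + (a k - a k.+1) by ring.
  rewrite mulrDr; have h1 : (1 - q) * (a k - a k.+1) <=
      (1 - q) * (tau * (2 * (q ^+ k * e 0%N))).
    rewrite ler_wpM2l ?subr_ge0//; first exact: le_trans q1 rate_le1.
    by rewrite (le_trans (step k))// !ler_wpM2l// ltW.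
  rewrite (le_trans (lerD IH h1))// exprS.
  by rewrite le_eqVlt; apply/orP; left; apply/eqP; ring.
rewrite -(ler_pM2l tau_gt0).
have am : 0 <= a 0%N - a m by rewrite subr_ge0; exact: Ex_sqr_iter_le.
rewrite mulrA (_ : tau * (1 - _) = 1 - rate); last by rewrite /rate; ring.
apply: (@le_trans _ _ ((1 - q) * (a 0%N - a m))).
  by rewrite ler_wpM2r// lerB.
rewrite (le_trans tel)// mulrA ler_piMr ?mulr_ge0 ?(ltW tau_gt0)//.
by rewrite gerBl exprn_ge0// ltW.
Qed.

End specification.

(** * Local functions *)

Definition local {R : realType} {d : nat} (T : seq (site d)) (f : config d -> R) : Prop :=
  forall s s', (forall y, y \in T -> s y = s' y) -> f s = f s'.

Definition grow {d : nat} (L : seq (site d)) : seq (site d) :=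
  undup (L ++ flatten [seq nbrs x | x <- L]).

Section local_functions.
Context {R : realType} {d : nat}.
Implicit Types (f g : config d -> R) (T L : seq (site d)).

Lemma osc_le_set_spin f u x b s : osc_le f u ->
  `|f (set_spin x b s) - f s| <= u x.
Proof.
move=> fu; have [->|bs] := eqVneq b (s x).
  by rewrite set_spin_id subrr normr0; apply: le_trans (fu x s); exact: normr_ge0.
have -> : b = ~~ s x by move: b (s x) bs => [] [].
exact: fu.
Qed.

(** Changes the spins of [T] from [s] to [s'] one at a time; [mix V] is the configuration after
    those of [V]. *)
Lemma local_osc T f u s s' : local T f -> osc_le f u ->
  `|f s' - f s| <= \sum_(y <- T) u y.
Proof.
move=> fT fu; pose mix (V : seq (site d)) (y : site d) := if y \in V then s' y else s y.
have -> : f s' = f (mix T) by apply: fT => y yT; rewrite /mix yT.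
elim: T {fT} => [|x T IH].
  by rewrite big_nil (_ : mix [::] = s) ?subrr ?normr0.
rewrite big_cons; have -> : mix (x :: T) = set_spin x (s' x) (mix T).
  apply/funext => y; rewrite /mix /set_spin inE.
  by case: (eqVneq y x) => [->|].
apply: le_trans (ler_distD (f (mix T)) _ _) _.
by rewrite lerD// osc_le_set_spin.
Qed.

Lemma local_sub T T' f : {subset T <= T'} -> local T f -> local T' f.
Proof. by move=> TT fT s s' ss'; apply: fT => y /TT; exact: ss'. Qed.

Lemma mem_grow L : {subset L <= grow L}.
Proof. by move=> x xL; rewrite mem_undup mem_cat xL. Qed.

Lemma nbrs_grow L x y : x \in L -> y \in nbrs x -> y \in grow L.
Proof.
move=> xL yx; rewrite mem_undup mem_cat; apply/orP; right.
by apply/flattenP; exists (nbrs x) => //; exact: map_f.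
Qed.

Lemma iter_grow_sub (k n : nat) L : (k <= n)%N -> {subset iter k grow L <= iter n grow L}.
Proof.
move=> /subnK <-; elim: (n - k)%N => // j IH x /IH; exact: mem_grow.
Qed.

(** The lattice distance from [y] to [L], truncated at [n]. *)
Definition level L n (y : site d) : nat := \sum_(k < n) (y \notin iter k grow L).

(** If [x] lies in the [k]-th neighbourhood of [L], then [y] lies in the next one: the counts
    compare after shifting the index by one. *)
Lemma level_nbrs L n x y : y \in nbrs x -> (level L n.+1 y <= (level L n.+1 x).+1)%N.
Proof.
move=> yx; rewrite /level big_ord_recl /= -add1n leq_add ?leq_b1//.
rewrite [leqRHS]big_ord_recr /= (leq_trans _ (leq_addr _ _))//.
apply: leq_sum => k _.
case: (boolP (x \in iter k grow L)) => [xk|_]; last by case: (_ \notin _).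
by rewrite (nbrs_grow _ _ _ xk yx).
Qed.

Lemma level_out L n y : y \notin iter n grow L -> level L n.+1 y = n.+1.
Proof.
move=> yn; rewrite /level (eq_bigr (fun=> 1%N)); first by rewrite sum1_card card_ord.
move=> k _; case: (boolP (y \in _)) => // /(iter_grow_sub _ n); rewrite -ltnS ltn_ord.
by move=> /(_ isT); rewrite (negbTE yn).
Qed.

Lemma level_in L n y : y \in L -> level L n y = 0%N.
Proof.
move=> yL; rewrite /level big1// => k _.
by rewrite (iter_grow_sub 0 k _ (leq0n _) _ yL).
Qed.

(** Resampling at [x] reads only the neighbours of [x] and the spins that [f] reads, all of them in
    [T]. *)
Lemma local_iter_glauber (pi : site d -> config d -> R) L T tau m f :
  (forall x s s', (forall y, y \in nbrs x -> s y = s' y) -> pi x s = pi x s') ->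
  (forall x y, x \in L -> y \in nbrs x -> y \in T) ->
  local T f -> local T (iter m (glauber pi L tau) f).
Proof.
move=> ploc LT fT; elim: m => //= m; move: (iter m _ f) => {fT}f fT s s' ss'.
rewrite /glauber (fT _ _ ss'); congr (_ - _ * _).
apply: eq_big_seq => x xL; rewrite /heat_bath (ploc _ _ s'); last first.
  by move=> y yx; apply/ss'/(LT x).
have E b : f (set_spin x b s) = f (set_spin x b s').
  by apply: fT => y yT; rewrite /set_spin; case: eqP => // _; exact: ss'.
by rewrite !E.
Qed.

End local_functions.

(** * Density of local functions in mean square *)

Section approximation.
Context {R : realType} {d : nat}.
Variable P : probability (Omega d) R.
Local Notation bm := (@bounded_measurable R _ (Omega d)).

(** The measurable sets whose indicators are L1 limits of local functions with values in [[0, 1]]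
    form a sigma-algebra containing the coordinate sets. *)
Lemma indic_local_approx (A : set (Omega d)) (e : R) : measurable A -> 0 < e ->
  exists T g, [/\ bm g, local T g, forall s, 0 <= g s <= 1 &
    Ex P (fun s => `|\1_A s - g s|) <= e].
Proof.
pose approx (B : set (Omega d)) := forall e : R, 0 < e ->
  exists T g, [/\ bm g, local T g, forall s, 0 <= g s <= 1 &
    Ex P (fun s => `|\1_B s - g s|) <= e].
have bmN f : bm f -> bm (fun s => `|f s|).
  move=> [mf [M fM]]; split; first exact: measurableT_comp.
  by exists M => s; rewrite normr_id.
suff : measurable `<=` [set B | measurable B /\ approx B].
  by move=> H mA e0; have [_] := H A mA; exact.
have approxU B C : measurable B -> measurable C -> approx B -> approx C -> approx (B `|` C).
  move=> mB mC aB aC r r0; have r20 : 0 < r / 2 by rewrite divr_gt0.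
  have [T [g [bg gT g01 gB]]] := aB _ r20; have [T' [g' [bg' gT' g01' gC]]] := aC _ r20.
  have b1g : bm (fun s => 1 - g s) by apply: bmB => //; exact: bm_cst.
  have b1g' : bm (fun s => 1 - g' s) by apply: bmB => //; exact: bm_cst.
  exists (T ++ T'), (fun s => 1 - (1 - g s) * (1 - g' s)); split.
  - by apply: bmB; [exact: bm_cst|exact: bmM].
  - move=> s s' ss'; rewrite (gT s s') ?(gT' s s')// => y yT; apply: ss'.
      by rewrite mem_cat yT orbT.
    by rewrite mem_cat yT.
  - move=> s; have /andP[? ?] := g01 s; have /andP[? ?] := g01' s.
    by apply/andP; split; nra.
  - have bB : bm (fun s => `|\1_B s - g s|).
      by apply: (bmN (fun s => _ - _)); apply: bmB => //; exact: bm_indic.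
    have bC : bm (fun s => `|\1_C s - g' s|).
      by apply: (bmN (fun s => _ - _)); apply: bmB => //; exact: bm_indic.
    apply: (@le_trans _ _ (Ex P (fun s => `|\1_B s - g s| + `|\1_C s - g' s|))); last first.
      by rewrite ExD// (splitr r) lerD.
    apply: le_Ex; [|exact: bmD|].
      apply: (bmN (fun s => _ - _)); apply: bmB.
        by apply: bm_indic; exact: measurableU.
      by apply: bmB; [exact: bm_cst|exact: bmM].
    move=> s; have /andP[? ?] := g01 s; have /andP[? ?] := g01' s.
    rewrite !indicE in_setU.
    set b := s \in B; set c := s \in C.
    (* The union error splits into the two errors, each multiplied by a factor of absolute value at
       most one. *)
    have -> : (b || c)%:R - (1 - (1 - g s) * (1 - g' s)) =
        (b%:R - g s) * (1 - g' s) + (1 - b%:R) * (c%:R - g' s) :> R.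
      by case: b; case: c => /=; ring.
    rewrite (le_trans (ler_normD _ _))// !normrM lerD//.
      by rewrite ler_piMr// ger0_norm ?subr_ge0// gerBl.
    by rewrite ler_piMl//; case: b; rewrite ?subrr ?subr0 ?normr0 ?normr1.
have approx_bigcup (F : nat -> set (Omega d)) :
    (forall n, measurable (F n) /\ approx (F n)) ->
    measurable (\bigcup_n F n) /\ approx (\bigcup_n F n).
  move=> aF.
  have mF n : measurable (F n) by have [] := aF n.
  pose U n := \big[setU/set0]_(i < n) F i.
  have mU n : measurable (U n) by exact: bigsetU_measurable.
  have mUF : measurable (\bigcup_n F n) by exact: bigcupT_measurable.
  have aU n : approx (U n).
    elim: n => [|n IH]; last first.
      by rewrite /U big_ord_recr; apply: approxU; [exact: mU|exact: mF|exact: IH|have [] := aF n].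
    move=> r r0; exists [::], (fun=> 0); split => // [|s|].
    + exact: bm_cst.
    + by rewrite lexx ler01.
    + rewrite (_ : (fun s => _) = fun=> 0) ?Ex_cst ?ltW//.
      by apply/funext => s; rewrite /U big_ord0 indic0 subrr normr0.
  split => // r r0; have r20 : 0 < r / 2 by rewrite divr_gt0.
  have UF n : U n `<=` \bigcup_n F n.
    by rewrite /U -bigcup_mkord => s [i _ Fis]; exists i.
  (* Continuity from below reduces the countable union to a finite one. *)
  have [n nE] : exists n, Ex P \1_(\bigcup_n F n) - Ex P \1_(U n) <= r / 2.
    have cv : P \o U @ \oo --> P (\bigcup_n F n).
      have UE : \bigcup_n U n = \bigcup_n F n.
        apply/seteqP; split => [s [n _ /UF]//|s [n _ Fns]]; exists n.+1 => //.
        by rewrite /U -bigcup_mkord; exists n => /=.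
      rewrite -UE; apply: nondecreasing_cvg_mu; [exact: mU|by rewrite UE|].
      by move=> i j ij; apply/subsetPset; exact: subset_bigsetU.
    have {}cv : (fun n => (Ex P \1_(U n))%:E) @ \oo --> (Ex P \1_(\bigcup_n F n))%:E.
      rewrite Ex_indic// (_ : (fun n => _) = P \o U)//.
      by apply/funext => n; rewrite Ex_indic.
    move/fine_cvg: cv => /cvgrPdist_le /(_ _ r20) [N _ HN]; exists N.
    by apply: le_trans (HN N (leqnn N)); exact: ler_norm.
  have [T [g [bg gT g01 gB]]] := aU n _ r20.
  exists T, g; split => //.
  have bn B : measurable B -> bm (fun s => `|\1_B s - g s|).
    by move=> mB; apply: (bmN (fun s => _ - _)); apply: bmB => //; exact: bm_indic.
  apply: (@le_trans _ _ (Ex P (fun s => (\1_(\bigcup_n F n) s - \1_(U n) s) +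
      `|\1_(U n) s - g s|))).
    apply: le_Ex => [||s]; first exact: bn.
      by apply: bmD; [apply: bmB; exact: bm_indic|exact: bn].
    rewrite !indicE; case: (boolP (s \in U n)) => sU.
      rewrite (_ : s \in \bigcup_n F n) ?subrr ?add0r//.
      by move: sU; rewrite !inE; exact: UF.
    by rewrite subr0 (le_trans (ler_normB _ _))// sub0r normrN ger0_norm.
  rewrite ExD ?ExB; [|exact: bm_indic|exact: bm_indic| |exact: bn].
    by rewrite (splitr r) lerD.
  by apply: bmB; exact: bm_indic.
apply: smallest_sub; first split => [|B [mB aB]|F aF].
- split => [//|r r0]; exists [::], (fun=> 0); split => // [|s|].
  + exact: bm_cst.
  + by rewrite lexx ler01.
  + rewrite (_ : (fun s => _) = fun=> 0) ?Ex_cst ?ltW//.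
    by apply/funext => s; rewrite indic0 subrr normr0.
- split; first by rewrite setTD; exact: measurableC.
  move=> r r0; have [T [g [bg gT g01 gB]]] := aB _ r0.
  exists T, (fun s => 1 - g s); split.
  + by apply: bmB => //; exact: bm_cst.
  + by move=> s s' ss'; rewrite (gT s s').
  + by move=> s; have /andP[? ?] := g01 s; apply/andP; split; lra.
  + rewrite (_ : (fun s => _) = fun s => `|\1_B s - g s|)//.
    apply/funext => s; rewrite setTD !indicE in_setC -normrN; congr (`|_|).
    by case: (s \in B) => /=; ring.
- exact: approx_bigcup.
move=> B [y [b ->]]; have mB := @measurable_coord d y b; split => // r r0.
exists [:: y], \1_[set s : Omega d | s y = b]; split.
- exact: bm_indic.
- move=> s s' ss'; rewrite !indicE; congr (_ : bool)%:R.
  by apply/idP/idP; rewrite !inE /= (ss' y)// inE.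
- by move=> s; rewrite indicE; case: (_ \in _); rewrite /= ?lexx ler01.
- rewrite (_ : (fun s => _) = fun=> 0) ?Ex_cst ?ltW//.
  by apply/funext => s; rewrite subrr normr0.
Qed.

(** Induction by [bm_ind]. An indicator error lies in [[-1, 1]], so its square is at most its
    absolute value and L1 closeness suffices. *)
Lemma sqr_local_approx (f : Omega d -> R) (e : R) : bm f -> 0 < e ->
  exists T g, [/\ bm g, local T g & Ex P (fun s => (f s - g s) ^+ 2) <= e].
Proof.
move=> bf; move: f bf e; apply: bm_ind.
- move=> e e0; exists [::], (fun=> 0); split => //; first exact: bm_cst.
  rewrite (_ : (fun s => _) = fun=> 0) ?Ex_cst ?ltW//.
  by apply/funext => s; rewrite subrr expr0n.
- move=> f a A bf fH mA e e0.
  have e1 : 0 < e / 4 by rewrite divr_gt0.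
  have a1 : 0 < a ^+ 2 + 1 by rewrite ltr_wpDl ?sqr_ge0.
  (* Chosen so that [2 * a ^+ 2] times it is at most [e / 2]; the [+ 1] covers [a = 0]. *)
  have e2 : 0 < e / 4 / (a ^+ 2 + 1) by rewrite divr_gt0.
  have [T [g [bg gT gE]]] := fH _ e1.
  have [T' [g' [bg' gT' g01 gE']]] := indic_local_approx _ _ mA e2.
  have bfg := bmX2 _ (bmB _ _ bf bg).
  have bA : bm (fun s => \1_A s - g' s) by apply: bmB => //; exact: bm_indic.
  have bn : bm (fun s => `|\1_A s - g' s|).
    have [mm [M hM]] := bA; split; first exact: measurableT_comp.
    by exists M => s; rewrite normr_id.
  exists (T ++ T'), (fun s => g s + a * g' s); split.
  + by apply: bmD => //; exact: bmZ.
  + move=> s s' ss'; rewrite (gT s s') ?(gT' s s')// => y yT; apply: ss'.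
      by rewrite mem_cat yT orbT.
    by rewrite mem_cat yT.
  + apply: (@le_trans _ _ (Ex P (fun s => 2 * (f s - g s) ^+ 2 +
        2 * a ^+ 2 * `|\1_A s - g' s|))).
      apply: le_Ex => [||s].
      * apply: bmX2; apply: bmB; first by apply: bmD => //; apply: bmZ; exact: bm_indic.
        by apply: bmD => //; exact: bmZ.
      * by apply: bmD; exact: bmZ.
      have /andP[? ?] := g01 s; set k := \1_A s - g' s; set z := f s - g s.
      have -> : f s + a * \1_A s - (g s + a * g' s) = z + a * k by rewrite /z /k; ring.
      have hk : k ^+ 2 <= `|k|.
        rewrite -real_normK ?num_real// expr2 ler_piMl// /k indicE.
        by rewrite ler_norml; case: (s \in A) => /=; apply/andP; split; lra.
      have := sqr_ge0 (z - a * k); have := ler_wpM2l (sqr_ge0 a) hk.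
      by rewrite -mulrA !expr2; nra.
    rewrite ExD ?ExZ//; [|exact: bmZ|exact: bmZ].
    have h1 : 2 * a ^+ 2 * Ex P (fun s => `|\1_A s - g' s|) <= e / 2.
      have := ler_wpM2l (sqr_ge0 a) gE'.
      have : a ^+ 2 * (e / 4 / (a ^+ 2 + 1)) <= e / 4.
        rewrite mulrCA ler_piMr ?(ltW e1)// ler_pdivrMr// mul1r lerDl ler01//.
      move: (a ^+ 2 * (e / 4 / (a ^+ 2 + 1))) => v; rewrite -mulrA.
      by move: (a ^+ 2 * Ex P _) => u; lra.
    by move: gE h1; set x := Ex P _; set y := _ * Ex P _; lra.
- move=> f bf lim e e0.
  have e1 : 0 < e / 4 by rewrite divr_gt0.
  have s1 : 0 < Num.sqrt (e / 4) by rewrite sqrtr_gt0.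
  have [h bh [hH fh]] := lim _ s1.
  have [T [g [bg gT gE]]] := hH _ e1.
  exists T, g; split => //.
  have bhg := bmX2 _ (bmB _ _ bh bg).
  apply: (@le_trans _ _ (Ex P (fun s => e / 2 + 2 * (h s - g s) ^+ 2))).
    apply: le_Ex => [||s].
    + by apply: bmX2; exact: bmB.
    + by apply: bmD; [exact: bm_cst|exact: bmZ].
    have hs : (f s - h s) ^+ 2 <= e / 4.
      rewrite -(sqr_sqrtr (ltW e1)) -[leLHS]real_normK ?num_real//.
      by rewrite ler_sqr ?nnegrE ?sqrtr_ge0//; exact: fh.
    have -> : f s - g s = (f s - h s) + (h s - g s) by ring.
    move: hs; set a := f s - h s; set b := h s - g s => hs.
    have := sqr_ge0 (a - b); move: hs; rewrite !expr2; nra.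
  rewrite ExD; [|exact: bm_cst|exact: bmZ]; rewrite Ex_cst ExZ//.
  by move: gE; set x := Ex P _; lra.
Qed.

End approximation.

(** * Poincare inequality in the Dobrushin regime *)

Section poincare.
Context {R : realType} {d : nat}.
Variables (pi : site d -> config d -> R) (P : probability (Omega d) R) (c : R).
Hypothesis pi01 : forall x s, 0 <= pi x s <= 1.
Hypothesis pi_meas : forall x, measurable_fun [set: Omega d] (pi x : Omega d -> R).
Hypothesis pi_loc : forall x s s',
  (forall y, y \in nbrs x -> s y = s' y) -> pi x s = pi x s'.
Hypothesis pi_cond : forall (x : site d) (B : set (Omega d)), off_site_sets x B ->
  (P ([set s : Omega d | s x = true] `&` B) = \int[P]_(s in B) (pi x s)%:E)%E.
Hypothesis pi_osc : forall x y s, `|pi x (flip y s) - pi x s| <= c.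
Hypothesis c_ge0 : 0 <= c.
Hypothesis c_small : c * (2 * d)%:R * 2 <= 1.
Local Notation bm := (@bounded_measurable R _ (Omega d)).

Let c_lt1 : c * (2 * d)%:R < 1.
Proof.
have := c_small; have : 0 <= c * (2 * d)%:R by exact: mulr_ge0.
by move: (c * _) => z; lra.
Qed.

Lemma Ex_iter_glauber L tau m f : bm f ->
  Ex P (iter m (glauber pi L tau) f) = Ex P f.
Proof.
move=> bf; elim: m => //= m <-; apply: Ex_glauber => //.
exact: iter_glauber_bm.
Qed.

Lemma sub_Ex_le f B : bm f -> (forall s s', `|f s' - f s| <= B) ->
  forall s, `|f s - Ex P f| <= B.
Proof.
move=> bf fB s; rewrite -{1}(Ex_cst P (f s)) -ExB//; last exact: bm_cst.
by apply: norm_Ex_le => [|s']; [apply: bmB => //; exact: bm_cst|exact: fB].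
Qed.

Lemma expr_le_small (q C e : R) : 0 <= q -> q < 1 -> 0 < e ->
  exists m, q ^+ m * C <= e.
Proof.
move=> q0 q1 e0; have C1 : 0 < `|C| + 1 by rewrite ltr_wpDl.
have : GRing.exp q n @[n --> \oo] --> 0 by apply: cvg_expr; rewrite ger0_norm.
move=> /cvgrPdist_le /(_ _ (divr_gt0 e0 C1)) [m _ hm]; exists m.
have := hm m (leqnn m); rewrite /= sub0r normrN ger0_norm ?exprn_ge0// => qm.
rewrite (le_trans (ler_norm _))// normrM ger0_norm ?exprn_ge0//.
rewrite (le_trans (ler_wpM2r (normr_ge0 C) qm))// -mulrA ler_piMr ?(ltW e0)//.
by rewrite ler_pdivrMl// mulr1 lerDl.
Qed.

(** The oscillation inside [L] dies out with [m]. The part on the outer layer of [T] carries weight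
    [2 ^+ n.+2], while the weighted total never exceeds its initial bound [B]. *)
Lemma local_mixing f T0 e : bm f -> local T0 f -> 0 < e ->
  exists L tau m, [/\ uniq L, 0 < tau, tau < 1, tau * (size L)%:R <= 1 &
    forall s, `|iter m (glauber pi L tau) f s - Ex P f| <= e].
Proof.
move=> bf fT e0; have [_ [M fM]] := bf.
have M0 : 0 <= M by apply: le_trans (fM point); exact: normr_ge0.
have M20 : 0 <= 2 * M by exact: mulr_ge0.
pose u (y : site d) := (y \in T0)%:R * (2 * M).
have u0 y : 0 <= u y by exact: mulr_ge0.
have fu : osc_le f u.
  move=> y s; rewrite /u; case: (boolP (y \in T0)) => yT.
    rewrite mul1r (le_trans (ler_normB _ _))//.
    by rewrite mulr2n mulrDl !mul1r lerD.
  rewrite mul0r (fT _ s) ?subrr ?normr0// => z zT.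
  by rewrite /flip; case: eqP => // zy; move: yT; rewrite -zy zT.
set B := (size T0)%:R * (2 * M).
have uB (w : site d -> R) T : uniq T -> (forall y, y \in T0 -> w y = 1) ->
    \sum_(y <- T) w y * u y <= B.
  move=> uT w1; rewrite (eq_bigr (fun y => (y \in T0)%:R * (w y * (2 * M)))).
    by apply: sum_mem_le => // y /w1 ->; rewrite mul1r.
  by move=> y _; rewrite /u mulrCA.
have e20 : 0 < e / 2 by rewrite divr_gt0.
have [n nB] : exists n, 2^-1 ^+ n * B <= e / 2.
  by apply: expr_le_small => //; rewrite invf_lt1// ltr1n.
(* [T] adds to [L] the sites that its conditional probabilities read, so the iterates remain local
   on [T]. *)
set L := iter n.+1 grow T0; set T := grow L.
have uL : uniq L by exact: undup_uniq.
have uT : uniq T by exact: undup_uniq.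
(* The [+ 2] keeps [tau] strictly below one even when [L] is empty. *)
set tau := ((size L).+2%:R : R)^-1.
have tau0 : 0 < tau by rewrite invr_gt0.
have tau1 : tau < 1 by rewrite invf_lt1// ltr1n.
have tauL : tau * (size L)%:R <= 1.
  by rewrite mulrC ler_pdivrMr// mul1r ler_nat leqW.
have r1 : @rate R d c tau < 1.
  by rewrite /rate gtrBl mulr_gt0// subr_gt0.
have r0 : 0 <= @rate R d c tau by rewrite ltW// rate_gt0.
have [m mB] := expr_le_small _ B _ r0 r1 e20.
exists L, tau, m; split => // s.
rewrite -(Ex_iter_glauber L tau m)//.
apply: sub_Ex_le; first exact: iter_glauber_bm.
move=> {}s s'; set v := iter m (osc_step L c tau) u.
have v0 y : 0 <= v y by exact: iter_osc_step_ge0.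
have fv : osc_le (iter m (glauber pi L tau) f) v by exact: osc_iter.
have lT : local T (iter m (glauber pi L tau) f).
  apply: local_iter_glauber => // [x y xL yx|]; first exact: nbrs_grow xL yx.
  apply: local_sub fT => y yT; exact: (iter_grow_sub 0 n.+2).
apply: (le_trans (local_osc _ _ _ s s' lT fv)).
pose w (y : site d) : R := 2 ^+ level T0 n.+2 y.
have w0 y : 0 <= w y by exact: exprn_ge0.
have w1 y : y \in T0 -> w y = 1 by move=> yT; rewrite /w level_in.
(* The weight at most doubles between neighbours, and [c_small] absorbs exactly this factor 2. *)
have wv : \sum_(y <- T) w y * v y <= B.
  rewrite /v; elim: (m) => [|k IH]; first exact: uB.
  apply: le_trans IH.
  apply: (le_trans (osc_step_sum L c tau uL c_ge0 tau0 T w _ 2 uT _ w0 _ _ _)) => //.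
  - exact: mem_grow.
  - move=> x y _ yx; rewrite /w -exprS ler_eXn2l ?ltr1n//; exact: level_nbrs.
  - exact: iter_osc_step_ge0.
  - rewrite gerBl mulr_ge0//; first by rewrite mulr_ge0 ?(ltW tau0)// subr_ge0.
    by apply: sumr_ge0 => x _; rewrite mulr_ge0// iter_osc_step_ge0.
have vL : \sum_(y <- L) v y <= e / 2.
  rewrite (le_trans _ mB)// (le_trans (iter_osc_step_sum _ _ _ _ _ _ _ _ _ _))//.
  rewrite ler_wpM2l ?exprn_ge0//.
  have := uB (fun=> 1) L uL (fun _ _ => erefl).
  by under eq_bigr do rewrite mul1r.
rewrite (splitr e).
(* Sites of [T] outside [L] have level [n.+2], so [w] cancels [2^-1 ^+ n.+2] there. *)
apply: (@le_trans _ _ (\sum_(y <- T) (y \in L)%:R * v y + 2^-1 ^+ n.+2 * B)); last first.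
  apply: lerD.
    rewrite (le_trans _ vL)//.
    apply: (@le_trans _ _ (\sum_(y <- [seq y <- T | y \in L]) v y)).
      rewrite big_filter [leRHS]big_mkcond; apply: ler_sum => y _.
      by case: (y \in L); rewrite ?mul1r ?mul0r.
    rewrite (perm_big L)//; apply: uniq_perm => // [|y]; first exact: filter_uniq.
    by rewrite mem_filter andb_idr// => /mem_grow.
  apply: le_trans nB; rewrite ler_wpM2r//; first exact: mulr_ge0.
  by rewrite !exprS mulrA ler_piMl ?exprn_ge0//; lra.
apply: (@le_trans _ _ (\sum_(y <- T) (y \in L)%:R * v y +
    2^-1 ^+ n.+2 * \sum_(y <- T) w y * v y)); last first.
  by rewrite lerD2l ler_wpM2l// exprn_ge0.
rewrite mulr_sumr -big_split /=; apply: ler_sum => y _.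
case: (boolP (y \in L)) => yL.
  by rewrite mul1r lerDl mulr_ge0 ?exprn_ge0// mulr_ge0.
by rewrite mul0r add0r /w level_out// mulrA -exprMn mulVf ?expr1n ?mul1r.
Qed.

Lemma sqr_Ex_le f : bm f -> Ex P f ^+ 2 <= Ex P (fun s => f s ^+ 2).
Proof.
move=> bf; rewrite -subr_ge0.
have := Ex_ge0 P (fun s => (f s - Ex P f) ^+ 2) (fun=> sqr_ge0 _).
rewrite [X in Ex P X](_ : _ = fun s => f s ^+ 2 - (2 * Ex P f) * f s + Ex P f ^+ 2).
  rewrite ExD ?Ex_cst; [|apply: bmB; [exact: bmX2|exact: bmZ]|exact: bm_cst].
  rewrite ExB; [|exact: bmX2|exact: bmZ].
  by rewrite ExZ//; move: (Ex P f) (Ex P _) => a b; rewrite !expr2; lra.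
by apply/funext => s; ring.
Qed.

Lemma iter_glauberB L tau m f g :
  iter m (glauber pi L tau) (fun s => f s - g s) =
  fun s => iter m (glauber pi L tau) f s - iter m (glauber pi L tau) g s.
Proof. by elim: m => //= m ->; rewrite glauberB. Qed.

Lemma iter_glauber_cst L tau m a :
  iter m (glauber pi L tau) (fun=> a) = fun=> a.
Proof. by elim: m => //= m ->; rewrite glauber_cst. Qed.

(** Replaces [f] by a local [g]: [K] contracts the mean square of [f - g], [g] mixes uniformly, and
    the means are close. Each of the three errors has mean square at most [e / 9], and squaring a
    sum of three costs a factor 3. *)
Lemma L2_mixing f e : bm f -> 0 < e ->
  exists L tau m, [/\ uniq L, 0 < tau, tau < 1, tau * (size L)%:R <= 1 &
    Ex P (fun s => (iter m (glauber pi L tau) f s - Ex P f) ^+ 2) <= e].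
Proof.
move=> bf e0; have e1 : 0 < e / 9 by rewrite divr_gt0.
have [T [g [bg gT fg]]] := sqr_local_approx P _ _ bf e1.
have s0 : 0 < Num.sqrt (e / 9) by rewrite sqrtr_gt0.
have [L [tau [m [uL t0 t1 tL mix]]]] := local_mixing _ _ _ bg gT s0.
exists L, tau, m; split => //.
have bfg : bm (fun s => f s - g s) by exact: bmB.
have bK := iter_glauber_bm pi pi01 pi_meas L tau m _ bfg.
have bKf := iter_glauber_bm pi pi01 pi_meas L tau m _ bf.
set D := Ex P f - Ex P g.
have hD : D ^+ 2 <= e / 9 by rewrite /D -ExB// (le_trans (sqr_Ex_le _ _)).
apply: (@le_trans _ _ (Ex P (fun s =>
    3 * iter m (glauber pi L tau) (fun s => f s - g s) s ^+ 2 + 3 * (e / 9 + e / 9)))).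
  apply: le_Ex => [||s].
  - by apply: bmX2; apply: bmB => //; exact: bm_cst.
  - by apply: bmD; [apply: bmZ; exact: bmX2|exact: bm_cst].
  have {}mix : (iter m (glauber pi L tau) g s - Ex P g) ^+ 2 <= e / 9.
    rewrite -(sqr_sqrtr (ltW e1)) -[leLHS]real_normK ?num_real//.
    by rewrite ler_sqr ?nnegrE ?sqrtr_ge0//; exact: mix.
  rewrite iter_glauberB; move: mix hD.
  have -> : iter m (glauber pi L tau) f s - Ex P f =
      (iter m (glauber pi L tau) f s - iter m (glauber pi L tau) g s) +
      (iter m (glauber pi L tau) g s - Ex P g) - D by rewrite /D; ring.
  move: (_ - _) (_ - Ex P g) D => a b D'.
  have := sqr_ge0 (a - b); have := sqr_ge0 (a + D'); have := sqr_ge0 (b + D').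
  by rewrite !expr2; nra.
rewrite ExD; [|apply: bmZ; exact: bmX2|exact: bm_cst].
rewrite Ex_cst ExZ; last exact: bmX2.
have := Ex_sqr_iter_le pi P pi01 pi_meas pi_cond L tau t0 tL m _ bfg.
by move: fg; move: (Ex P _) (Ex P _) => a b; lra.
Qed.

Lemma dform_le_flip L f : bm f -> dform pi P L f f <=
  \sum_(x <- L) Ex P (fun s : Omega d => (f (flip x s) - f s) ^+ 2).
Proof.
move=> bf; apply: ler_sum => x _.
have E s : (f (flip x s) - f s) ^+ 2 = diff x f s ^+ 2.
  have -> : f s = f (set_spin x (s x) s) by rewrite set_spin_id.
  by rewrite flipE /diff; case: (s x) => //=; rewrite -sqrrN opprB.
rewrite [leRHS](_ : _ = Ex P (fun s : Omega d => diff x f s ^+ 2)).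
  apply: le_Ex => [||s]; [exact: dform_bm|by apply: bmX2; exact: diff_bm|].
  have /andP[p0 p1] := pi01 x s.
  rewrite -mulrA -expr2 ler_piMl ?sqr_ge0// -[leRHS]mulr1.
  by rewrite ler_pM ?subr_ge0// gerBl.
by congr Ex; apply/funext => s; rewrite E.
Qed.

(** Applies [L2_decay_le] to the centred [f]; what remains of its squared norm after [m] steps is at
    most [e]. The constant does not depend on [L], which varies with [e]. *)
Lemma poincare_bounded f e : bm f -> 0 < e ->
  exists2 L, uniq L & Ex P (fun s => (f s - Ex P f) ^+ 2) <=
    2 / (1 - c * (2 * d)%:R) *
    \sum_(x <- L) Ex P (fun s : Omega d => (f (flip x s) - f s) ^+ 2) + e.
Proof.
move=> bf e0; have [L [tau [m [uL t0 t1 tL mix]]]] := L2_mixing _ _ bf e0.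
exists L => //.
have bh : bm (fun s => f s - Ex P f) by apply: bmB => //; exact: bm_cst.
have c1 : 0 < 1 - c * (2 * d)%:R by rewrite subr_gt0.
have := L2_decay_le pi P pi01 pi_meas pi_loc pi_cond L c tau uL pi_osc c_ge0 t0
  tL t1 c_lt1 _ m bh.
rewrite mulrC -ler_pdivlMr// iter_glauberB iter_glauber_cst.
have -> : dform pi P L (fun s => f s - Ex P f) (fun s => f s - Ex P f) = dform pi P L f f.
  apply: eq_bigr => x _; congr Ex; apply/funext => s; rewrite /diff; ring.
move=> H; have := dform_le_flip L _ bf; set D := \sum_(x <- L) _ => fD.
have : 2 * dform pi P L f f / (1 - c * (2 * d)%:R) <= 2 / (1 - c * (2 * d)%:R) * D.
  by rewrite mulrAC ler_wpM2l// divr_ge0// ltW.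
by move: mix H; lra.
Qed.

End poincare.

(** * Truncation and the passage to square-integrable functions *)

Definition clamp {R : realType} (M a : R) : R := Num.max (- M) (Num.min a M).

Section clamp.
Context {R : realType}.
Implicit Types M a b : R.

Lemma clamp_id M a : `|a| <= M -> clamp M a = a.
Proof.
by rewrite ler_norml /clamp => /andP[Ma aM]; rewrite (min_idPl aM) (max_idPr Ma).
Qed.

Lemma norm_clamp_le M a : 0 <= M -> `|clamp M a| <= M.
Proof.
move=> M0; rewrite /clamp ler_norml; apply/andP; split.
  by rewrite le_max lexx.
by rewrite ge_max; apply/andP; split; [lra|rewrite ge_min lexx orbT].
Qed.

Lemma clamp_lip M a b : 0 <= M -> `|clamp M a - clamp M b| <= `|a - b|.
Proof.
move=> M0; wlog ab : a b / a <= b => [H|].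
  have [ab|/ltW ba] := leP a b; first exact: H.
  by rewrite distrC (distrC a); exact: H.
have ab' : clamp M a <= clamp M b.
  by rewrite /clamp le_max2// le_min2.
rewrite distrC ger0_norm ?subr_ge0// distrC ger0_norm ?subr_ge0//.
rewrite /clamp /Num.max /Num.min.
by case: ifP; case: ifP; case: ifP; case: ifP => ? ? ? ?; lra.
Qed.

Lemma norm_clamp_le_norm M a : 0 <= M -> `|clamp M a| <= `|a|.
Proof.
move=> M0; have := clamp_lip M a 0 M0.
by rewrite (clamp_id M 0) ?normr0// !subr0.
Qed.

Lemma measurable_clamp M {d} {T : measurableType d} (f : T -> R) :
  measurable_fun setT f -> measurable_fun setT (fun s => clamp M (f s)).
Proof.
move=> mf; apply: measurable_maxr; first exact: measurable_cst.
by apply: measurable_minr => //; exact: measurable_cst.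
Qed.

End clamp.

Section square_integrable.
Context {R : realType} {d : nat}.
Variables (P : probability (Omega d) R) (C : R).
Hypothesis C_ge0 : 0 <= C.
Local Notation bm := (@bounded_measurable R _ (Omega d)).
Hypothesis poincare_bm : forall f e, bm f -> 0 < e ->
  exists2 L, uniq L & Ex P (fun s => (f s - Ex P f) ^+ 2) <=
    C * \sum_(x <- L) Ex P (fun s : Omega d => (f (flip x s) - f s) ^+ 2) + e.

(** On each value of the spin at [x], the flip coincides with one of the two measurable maps
    [set_spin x b]. *)
Lemma measurable_flip (f : Omega d -> R) x : measurable_fun [set: Omega d] f ->
  measurable_fun [set: Omega d] (fun s : Omega d => f (flip x s)).
Proof.
move=> mf; apply: (measurableT_comp mf) => _ A mA; rewrite setTI.
have mC b : measurable ([set s : Omega d | s x = b]) by exact: measurable_coord.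
have mS b : measurable (set_spin x b @^-1` A : set (Omega d)).
  by rewrite -[X in measurable X]setTI; exact: measurable_set_spin.
have -> : flip x @^-1` A =
    ([set s : Omega d | s x = true] `&` (set_spin x false @^-1` A)) `|`
    ([set s : Omega d | s x = false] `&` (set_spin x true @^-1` A)).
  apply/seteqP; split => [s|s []] /=; rewrite flipE.
  - by case: (s x) => /= h; [left|right].
  - by move=> [-> ].
  - by move=> [-> ].
by apply: measurableU; apply: measurableI.
Qed.

Lemma bm_flip (f : Omega d -> R) x : bm f -> bm (fun s : Omega d => f (flip x s)).
Proof.
move=> [mf [M fM]]; split; first exact: measurable_flip.
by exists M => s.
Qed.

(** Any finite sum over [L] is below the full Dirichlet form, after which [e] tends to zero. *)
Lemma poincare_bm_dirichlet f : bm f ->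
  ((Ex P (fun s => (f s - Ex P f) ^+ 2))%:E <= C%:E * dirichlet_form P f)%E.
Proof.
move=> bf; apply/lee_addgt0Pr => e e0.
have [L uL H] := poincare_bm _ _ bf e0.
apply: (@le_trans _ _ (C * \sum_(x <- L)
    Ex P (fun s : Omega d => (f (flip x s) - f s) ^+ 2) + e)%:E).
  by rewrite lee_fin.
rewrite EFinD leeD2r// EFinM lee_wpmul2l ?lee_fin//.
apply: esum_ge; exists [set` L]; first by split; [exact: finite_seq|].
rewrite -fsbig_seq// -sumEFin; apply: lee_sum => x _.
by rewrite EFin_Ex//; apply: bmX2; apply: bmB => //; exact: bm_flip.
Qed.

Lemma dirichlet_form_clamp (f : Omega d -> R) M : 0 <= M ->
  measurable_fun [set: Omega d] f ->
  (dirichlet_form P (fun s => clamp M (f s)) <= dirichlet_form P f)%E.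
Proof.
move=> M0 mf; apply: le_esum => x _; apply: ge0_le_integral => //.
- by move=> s _; rewrite lee_fin sqr_ge0.
- apply/measurable_EFinP; apply: measurable_funX; apply: measurable_funB.
    by apply: measurable_clamp; exact: measurable_flip.
  exact: measurable_clamp.
- apply/measurable_EFinP; apply: measurable_funX; apply: measurable_funB => //.
  exact: measurable_flip.
- move=> s _; rewrite lee_fin -[leLHS]real_normK ?num_real//.
  by rewrite -[leRHS]real_normK ?num_real// ler_sqr ?nnegrE// clamp_lip.
Qed.

(** Truncation is 1-Lipschitz and so does not increase the Dirichlet form; the means converge by
    dominated convergence and Fatou's lemma transfers the variance bound. *)
Lemma poincare_sqr_integrable (f : Omega d -> R) :
  measurable_fun [set: Omega d] f ->
  P.-integrable [set: Omega d] (fun s => (f s ^+ 2)%:E) ->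
  (\int[P]_(s in [set: Omega d])
      ((f s - fine (\int[P]_(t in [set: Omega d]) (f t)%:E)) ^+ 2)%:E
   <= C%:E * dirichlet_form P f)%E.
Proof.
move=> mf if2.
(* From [|f| <= 1 + f ^+ 2], a consequence of [(f - 1) ^+ 2 >= 0] and [(f + 1) ^+ 2 >= 0]. *)
have if1 : P.-integrable setT (EFin \o f).
  have i1 : P.-integrable setT (fun s => (1 + f s ^+ 2)%:E).
    exact: (integrableD measurableT (bm_integrable P (fun=> 1) (bm_cst 1)) if2).
  apply: le_integrable i1 => //; first exact/measurable_EFinP.
  move=> s _; rewrite /= lee_fin [leRHS]ger0_norm ?addr_ge0 ?sqr_ge0//.
  rewrite ler_norml; have := sqr_ge0 (f s - 1); have := sqr_ge0 (f s + 1).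
  by rewrite !expr2 => ? ?; apply/andP; split; nra.
pose fn n s := clamp n%:R (f s); pose a n := Ex P (fn n); pose A := Ex P f.
have bfn n : bm (fn n).
  by split; [exact: measurable_clamp|exists n%:R => s; exact: norm_clamp_le].
have fnE s : \forall n \near \oo, fn n s = f s.
  near=> n; apply: clamp_id; rewrite (le_trans (ltW (archi_boundP (normr_ge0 _))))//.
  by rewrite ler_nat; near: n; exact: nbhs_infty_ge.
have cf s : fn n s @[n --> \oo] --> f s.
  apply: cvg_near_cst; exact: fnE.
have ca : a n @[n --> \oo] --> A.
  have := @dominated_convergence _ _ R P setT measurableT
    (fun n s => (fn n s)%:E) (EFin \o f) (fun s => `|f s|%:E).
  case=> //.
  - by move=> n; apply/measurable_EFinP; exact: measurable_clamp.
  - exact/measurable_EFinP.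
  - by apply: aeW => s _; apply: cvg_EFin; [exact: nearW|exact: cf].
  - by have := integrable_abse if1.
  - by apply: aeW => s n _; rewrite /= lee_fin norm_clamp_le_norm.
  move=> _ _; rewrite (_ : [sequence _]_n = fun n => (a n)%:E); last first.
    by apply/funext => n; rewrite /a EFin_Ex.
  rewrite (_ : \int[P]_(x in setT) (EFin \o f) x = A%:E)%E; last first.
    by rewrite /A /Ex /Rintegral fineK//; exact: integrable_fin_num.
  by move/fine_cvg.
rewrite -/A.
pose g n s : \bar R := ((fn n s - a n) ^+ 2)%:E.
have cg s : g n s @[n --> \oo] --> ((f s - A) ^+ 2)%:E.
  apply: cvg_EFin; first exact: nearW.
  by apply: cvgM; apply: cvgB.
have gD n : (\int[P]_(s in setT) g n s <= C%:E * dirichlet_form P f)%E.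
  apply: (@le_trans _ _ (C%:E * dirichlet_form P (fn n))%E); last first.
    by rewrite lee_wpmul2l ?lee_fin//; exact: dirichlet_form_clamp.
  have := poincare_bm_dirichlet _ (bfn n); rewrite EFin_Ex//.
  by apply: bmX2; apply: bmB => //; exact: bm_cst.
have -> : (\int[P]_(s in [set: Omega d]) ((f s - A) ^+ 2)%:E =
    \int[P]_(s in [set: Omega d]) limn_einf (g^~ s))%E.
  by apply: eq_integral => s _; rewrite (cvg_limn_einf_sup (cg s)).1.
apply: le_trans.
  apply: fatou => //.
    move=> n; apply/measurable_EFinP; apply: measurable_funX.
    by apply: measurable_funB; [exact: measurable_clamp|exact: measurable_cst].
  by move=> n s _; rewrite lee_fin sqr_ge0.
(* Each tail infimum is at most its first term, which [gD] bounds uniformly. *)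
rewrite limn_einf_lim; apply: lime_le; first exact: is_cvg_einfs.
apply: nearW => n; apply: le_trans (gD n).
by apply: ereal_inf_lbound; exists n => /=.
Unshelve. all: end_near.
Qed.

End square_integrable.

(** * Single-site conditional probabilities and percolation *)

Section single_site.
Context {R : realType} {d : nat}.
Variables (beta h J : R).
Hypothesis beta_gt0 : 0 < beta.
Hypothesis J_pm1 : J = 1 \/ J = -1.
Local Notation pi := (@cond_plus R d beta h J).

Let energy (x : site d) (s : config d) : R := beta * h + beta * J * nbr_sum s x.

(** Logistic form, from which bounds, locality, measurability and oscillation are read off. *)
Lemma cond_plusE x s : pi x s = (1 + expR (- (2 * energy x s)))^-1.
Proof.
rewrite /cond_plus -expRD -/(energy x s); set a := energy x s.
have ea : expR a != 0 by rewrite gt_eqF ?expR_gt0.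
have -> : expR (- (2 * a)) = (expR a)^-1 ^+ 2.
  by rewrite -expRN -expRM_natl mulrN.
have e0 := expR_gt0 a.
rewrite expRN; field.
by apply/andP; split => //; apply: lt0r_neq0; rewrite addr_gt0// mulr_gt0.
Qed.

Lemma cond_plus01 x s : 0 <= pi x s <= 1.
Proof.
have e0 := expR_gt0 (- (2 * energy x s)).
by rewrite cond_plusE invr_ge0 invf_le1 ?lerDl ?(ltW e0) ?addr_ge0 ?ltr_wpDr// ?(ltW e0).
Qed.

Lemma cond_plus_local x s s' :
  (forall y, y \in nbrs x -> s y = s' y) -> pi x s = pi x s'.
Proof.
move=> ss'; rewrite !cond_plusE /energy; do 5 congr (_ _).
suff -> : nbr_sum s x = nbr_sum s' x :> R by [].
by apply: eq_bigr => i _; rewrite !ss'//; apply/nbrsP; exists i; [right|left].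
Qed.

Lemma measurable_cond_plus x :
  measurable_fun [set: Omega d] (pi x : Omega d -> R).
Proof.
have mE : measurable_fun [set: Omega d] (energy x : Omega d -> R).
  apply: measurable_funD; first exact: measurable_cst.
  apply: measurable_funM; first exact: measurable_cst.
  have bs y : bounded_measurable (fun s : Omega d => @spin R (s y)).
    rewrite (_ : (fun s => _) = fun s => 2 * \1_[set s : Omega d | s y = true] s - 1).
      apply: bmB; last exact: bm_cst.
      by apply: bmZ; apply: bm_indic; exact: measurable_coord.
    apply/funext => s; rewrite indicE /spin.
    have -> : (s \in [set s : Omega d | s y = true]) = s y by apply/idP/idP; rewrite inE.
    by case: (s y) => /=; ring.
  suff [] : bounded_measurable (fun s : Omega d => @nbr_sum R d s x) by [].
  by apply: bm_sum => i; apply: bmD; exact: bs.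
have -> : pi x = (fun a => (1 + expR (- (2 * a)))^-1) \o energy x.
  by apply/funext => s; rewrite cond_plusE.
apply: measurableT_comp mE; apply: continuous_measurable_fun => a.
apply: cvgV; first by rewrite gt_eqF// ltr_wpDr// expR_ge0.
apply: cvgD; first exact: cvg_cst.
apply: (@cvg_comp _ _ _ (fun a : R => - (2 * a)) expR); last exact: continuous_expR.
by apply: cvgN; apply: cvgM; [exact: cvg_cst|exact: cvg_id].
Qed.

Lemma norm_nbr_sum_le (s : config d) x : `|nbr_sum s x| <= 2 * d%:R :> R.
Proof.
rewrite (le_trans (ler_norm_sum _ _ _))//.
rewrite (_ : 2 * d%:R = \sum_(i < d) (2 : R)); last first.
  by rewrite sumr_const card_ord mulr_natr.
apply: ler_sum => i _; rewrite (le_trans (ler_normD _ _))//.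
by rewrite /spin; case: (s _); case: (s _); rewrite ?normrN normr1.
Qed.

(** The map [t |-> 1 / (1 + t)] is 1-Lipschitz for [t > 0], and the energy stays within
    [2 * beta * d] of [beta * h]. The bound is the percolation parameter [p]. *)
Lemma cond_plus_osc x s s' : `|pi x s' - pi x s| <=
  expR (- (2 * beta * h)) *
  (expR (4 * beta * d%:R) - expR (- (4 * beta * d%:R))).
Proof.
have E t : `|energy x t - beta * h| <= 2 * beta * d%:R.
  rewrite /energy addrAC subrr add0r !normrM (gtr0_norm beta_gt0).
  have -> : `|J| = 1 by case: J_pm1 => ->; rewrite ?normrN normr1.
  rewrite mulr1 (_ : 2 * beta * d%:R = beta * (2 * d%:R)); last by ring.
  by rewrite ler_pM2l// norm_nbr_sum_le.
have lip (a b : R) : a <= b -> `|(1 + expR (- (2 * b)))^-1 - (1 + expR (- (2 * a)))^-1|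
    <= expR (- (2 * a)) - expR (- (2 * b)).
  move=> ab; set u := expR (- (2 * a)); set v := expR (- (2 * b)).
  have u0 : 0 < u by exact: expR_gt0.
  have v0 : 0 < v by exact: expR_gt0.
  have vu : v <= u by rewrite ler_expR lerN2 ler_pM2l.
  have -> : (1 + v)^-1 - (1 + u)^-1 = (u - v) / ((1 + v) * (1 + u)).
    by field; rewrite !lt0r_neq0// addr_gt0.
  have p0 : 0 < (1 + v) * (1 + u) by rewrite mulr_gt0// addr_gt0.
  rewrite ger0_norm; last by rewrite divr_ge0 ?subr_ge0// ltW.
  rewrite ler_pdivrMr// ler_peMr ?subr_ge0//; nra.
have bnd a b : `|a - beta * h| <= 2 * beta * d%:R -> `|b - beta * h| <= 2 * beta * d%:R ->
    expR (- (2 * a)) - expR (- (2 * b)) <= expR (- (2 * beta * h)) *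
      (expR (4 * beta * d%:R) - expR (- (4 * beta * d%:R))).
  rewrite !ler_norml => /andP[a1 a2] /andP[b1 b2].
  by rewrite mulrBr -!expRD lerB// ler_expR; lra.
rewrite !cond_plusE; have [ab|/ltW ab] := leP (energy x s) (energy x s').
  by rewrite (le_trans (lip _ _ ab))// bnd.
by rewrite distrC (le_trans (lip _ _ ab))// bnd.
Qed.

End single_site.

(** * Lower bound on the cluster tail and smallness of the parameter *)

Section percolation.
Context {R : realType} {d : nat}.
Variables (Q : probability (Omega d) R) (p : R) (i0 : 'I_d).
Hypothesis Qp : bernoulli_site_percolation Q p.

Lemma measurable_all_seq {I : eqType} (l : seq I) (F : I -> set (Omega d)) :
  (forall i, measurable (F i)) ->
  measurable ([set w | forall i, i \in l -> F i w] : set (Omega d)).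
Proof.
move=> mF; elim: l => [|i l IH].
  by rewrite (_ : [set w | _] = setT)//; apply/seteqP; split.
rewrite (_ : [set w | _] = F i `&` [set w | forall i, i \in l -> F i w]).
  exact: measurableI.
apply/seteqP; split => w /=; [move=> H|move=> [Fi Fl] j].
  by split => [|j jl]; apply: H; rewrite inE ?eqxx// jl orbT.
by rewrite inE => /predU1P[->//|]; exact: Fl.
Qed.

(** A countable union over paths; for a fixed path the event is empty or constrains finitely many
    spins. *)
Lemma measurable_in_open_cluster (y : site d) :
  measurable ([set w | in_open_cluster w y] : set (Omega d)).
Proof.
rewrite (_ : [set w | _] = \bigcup_(s : seq (site d))
   [set w | [/\ last (origin d) s = y,
        (forall z, z \in origin d :: s -> w z = true) &
        (forall k, (k.+1 < size (origin d :: s))%N ->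
           nn (nth (origin d) (origin d :: s) k) (nth (origin d) (origin d :: s) k.+1))]]).
  apply: countable_bigcupT_measurable; first exact: countableP.
  move=> s; set C := forall k, _ -> nn _ _.
  have [[sy c]|H] := pselect (last (origin d) s = y /\ C); last first.
    rewrite (_ : [set w | _] = set0)//; apply/seteqP; split => // w [? _ ?].
    by apply: H.
  rewrite (_ : [set w | _] = [set w | forall z, z \in origin d :: s -> w z = true]).
    apply: (measurable_all_seq _ (fun z => [set w : Omega d | w z = true])) => z.
    exact: measurable_coord.
  by apply/seteqP; split => w // [].
by apply/seteqP; split => [w [s H]|w [s _ H]]; exists s.
Qed.

Lemma measurable_cluster_ge n : measurable (@cluster_ge d n).
Proof.
rewrite (_ : cluster_ge n = \bigcup_(L : seq (site d))
   [set w | [/\ uniq L, size L = n & forall y, y \in L -> in_open_cluster w y]]).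
  apply: countable_bigcupT_measurable; first exact: countableP.
  move=> L; have [[uL sL]|H] := pselect (uniq L /\ size L = n); last first.
    rewrite (_ : [set w | _] = set0)//; apply/seteqP; split => // w [? ? _].
    by apply: H.
  rewrite (_ : [set w | _] = [set w | forall y, y \in L -> in_open_cluster w y]).
    apply: (measurable_all_seq _ (fun y => [set w : Omega d | in_open_cluster w y])) => y.
    exact: measurable_in_open_cluster.
  by apply/seteqP; split => w // [].
by apply/seteqP; split => [w [L H]|w [L _ H]]; exists L.
Qed.

Definition ray (k : nat) : site d := [ffun j => if j == i0 then k%:Z else 0].

Lemma ray_inj : injective ray.
Proof. by move=> k l /ffunP/(_ i0); rewrite !ffunE eqxx => -[]. Qed.

Lemma nn_ray k : nn (ray k) (ray k.+1).
Proof.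
exists i0; left; apply/ffunP => j; rewrite !ffunE.
by case: (j == i0) => //; rewrite -addn1 PoszD.
Qed.

(** If the first [n] sites of a coordinate ray from the origin are open, each is joined to the
    origin along the ray. *)
Lemma cluster_ge_lower n : p ^+ n <= fine (Q (@cluster_ge d n)).
Proof.
set L := map ray (iota 0 n).
have uL : uniq L by rewrite map_inj_uniq ?iota_uniq//; exact: ray_inj.
have QL := Qp L (fun=> true) uL.
have mL : measurable [set w : Omega d | forall y, y \in L -> w y = true].
  apply: (measurable_all_seq _ (fun y => [set w : Omega d | w y = true])) => z.
  exact: measurable_coord.
have mC := measurable_cluster_ge n.
have -> : p ^+ n = fine (Q [set w : Omega d | forall y, y \in L -> w y = true]).
  by rewrite QL/= big_const_seq count_predT size_map size_iota iter_mulr_1.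
apply: fine_le; rewrite ?fin_num_measure//; apply: le_measure; rewrite ?inE//.
move=> w wL; exists L; split => //; first by rewrite size_map size_iota.
move=> y /mapP[k]; rewrite mem_iota add0n => /andP[_ kn] ->.
have o0 : origin d = ray 0 by apply/ffunP => j; rewrite !ffunE; case: ifP.
have E : origin d :: map ray (iota 1 k) = map ray (iota 0 k.+1) by rewrite /= o0.
exists (map ray (iota 1 k)); split.
- rewrite o0 last_map; congr ray.
  by rewrite (last_nth 0%N) size_iota -[_ :: _]/(iota 0 k.+1) nth_iota.
- move=> z; rewrite E => /mapP[j]; rewrite mem_iota add0n => /andP[_ jk] ->.
  by apply: wL; apply: map_f; rewrite mem_iota/= add0n (leq_ltn_trans _ kn).
- move=> j; rewrite E size_map size_iota => jk.
  rewrite !(nth_map 0%N) ?size_iota//; last exact: ltnW.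
  rewrite !nth_iota//; last exact: ltnW.
  exact: nn_ray.
Qed.

(** Otherwise [(2d - 1)^n p^(n/2) >= 1] for all [n], every term is at least 1, and the series
    diverges. *)
Lemma series_lt_pinfty_small (c' : R) : 0 <= c' -> 0 <= p ->
  (\sum_(1 <= n <oo)
      (n%:R * ((2 * d - 1)%N%:R) ^+ n * expR (c' * n%:R) *
       Num.sqrt (fine (Q (@cluster_ge d n))))%:E < +oo)%E ->
  ((2 * d - 1)%N%:R) ^+ 2 * p < 1.
Proof.
move=> c0 p0 fin; rewrite ltNge; apply/negP => p1.
set u := fun n : nat => (n%:R * ((2 * d - 1)%N%:R) ^+ n * expR (c' * n%:R) *
       Num.sqrt (fine (Q (@cluster_ge d n))))%:E : \bar R.
have u0 n : (0 <= u n)%E.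
  by rewrite lee_fin mulr_ge0 ?sqrtr_ge0// mulr_ge0 ?expR_ge0// mulr_ge0 ?exprn_ge0.
have u1 n : (1 <= n)%N -> (1 <= u n)%E.
  move=> n1; rewrite lee_fin.
  have a1 : 1 <= n%:R :> R by rewrite ler1n.
  have a2 : 1 <= expR (c' * n%:R) by rewrite -expR0 ler_expR mulr_ge0.
  have a3 : 1 <= ((2 * d - 1)%N%:R) ^+ n * Num.sqrt (fine (Q (@cluster_ge d n))).
    apply: (@le_trans _ _ (((2 * d - 1)%N%:R) ^+ n * Num.sqrt (p ^+ n))); last first.
      by rewrite ler_wpM2l ?exprn_ge0// ler_wsqrtr// cluster_ge_lower.
    have -> : ((2 * d - 1)%N%:R) ^+ n = Num.sqrt ((((2 * d - 1)%N%:R) ^+ 2) ^+ n) :> R.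
      by rewrite exprAC sqrtr_sqr ger0_norm// exprn_ge0.
    rewrite -sqrtrM ?exprn_ge0// -exprMn -[leLHS]sqrtr1 ler_wsqrtr//.
    exact: exprn_ege1.
  rewrite mulrAC -(mulrA n%:R); rewrite -[leLHS]mulr1 ler_pM// -[leLHS]mulr1.
  by rewrite ler_pM.
have S n : (n%:R%:E <= \sum_(1 <= k <oo) u k)%E.
  apply: le_trans (@nneseries_lim_ge R u xpredT 1%N n.+1 (fun k _ _ => u0 k)).
  have -> : (n%:R%:E = \sum_(1 <= k < n.+1) (1 : \bar R))%E.
    by rewrite sumEFin big_const_nat subn1 /= iter_addr_0.
  rewrite [leLHS]big_nat_cond [leRHS]big_nat_cond.
  by apply: lee_sum => k /andP[/andP[k1 _] _]; exact: u1.
set T := (\sum_(1 <= k <oo) u k)%E in fin S.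
have T0 : (0 <= T)%E by exact: S 0%N.
have Tf : T \is a fin_num by rewrite ge0_fin_numE.
have := S (Num.bound (fine T)); rewrite -(fineK Tf) lee_fin leNgt => /negP; apply.
by apply: archi_boundP; exact: fine_ge0.
Qed.

End percolation.

Theorem theorem2 (R : realType) (d : nat) (beta h J : R)
  (P : probability (Omega d) R) (Q : probability (Omega d) R) :
  (2 <= d)%N -> 0 < beta -> 0 <= h -> (J = 1 \/ J = -1) ->
  ising_single_site beta h J P ->
  let p := expR (- (2 * beta * h)) *
           (expR (4 * beta * d%:R) - expR (- (4 * beta * d%:R))) in
  p < 1 ->
  let c' := 4 * beta * d%:R in
  bernoulli_site_percolation Q p ->
  (\sum_(1 <= n <oo)
      (n%:R * ((2 * d - 1)%N%:R) ^+ n * expR (c' * n%:R) *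
       Num.sqrt (fine (Q (@cluster_ge d n))))%:E < +oo)%E ->
  exists CP : R, 0 < CP /\
    forall f : Omega d -> R,
      measurable_fun [set: Omega d] f ->
      P.-integrable [set: Omega d] (fun s => (f s ^+ 2)%:E) ->
      (\int[P]_(s in [set: Omega d])
          ((f s - fine (\int[P]_(t in [set: Omega d]) (f t)%:E)) ^+ 2)%:E
       <= CP%:E * dirichlet_form P f)%E.
Proof.
move=> d2 beta0 h0 J1 hP p _ c' hQ hS.
have c'0 : 0 <= c' by rewrite /c' !mulr_ge0// ltW.
have p0 : 0 <= p by rewrite mulr_ge0 ?expR_ge0// subr_ge0 ler_expR ge0_cp.
have pd := series_lt_pinfty_small Q p (Ordinal (ltnW d2)) hQ c' c'0 p0 hS.
(* [(2d - 1)^2 >= 4d] holds from [d = 2] on (9 against 8). *)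
have p_small : p * (2 * d)%:R * 2 <= 1.
  move: pd; rewrite natrB ?muln_gt0 ?(ltnW d2)// natrM => /ltW; apply: le_trans.
  have d2R : 2 <= d%:R :> R by rewrite ler_nat.
  by rewrite -mulrA mulrC ler_wpM2r//; nra.
have pg1 : p * (2 * d)%:R < 1.
  have : 0 <= p * (2 * d)%:R by exact: mulr_ge0.
  by move: p_small; move: (p * _) => z; lra.
have C0 : 0 < 2 / (1 - p * (2 * d)%:R) by rewrite divr_gt0// subr_gt0.
(* By [p_small] this constant is at most 4. *)
exists (2 / (1 - p * (2 * d)%:R)); split => // f mf f2.
apply: poincare_sqr_integrable => //; first exact: ltW.
move=> g e bg e0; apply: (poincare_bounded (@cond_plus R d beta h J)) => //.
- exact: cond_plus01.
- exact: measurable_cond_plus.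
- exact: cond_plus_local.
- by move=> x y s; exact: cond_plus_osc.
Qed.
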